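(* There exists a universal constant $C\le 0.5591$ (not depending on $n$ or $\theta$) such that the following holds. Let $(\theta_n)_{n\ge1}$ be a nondecreasing sequence of positive real numbers and write $\theta=\theta_n$. Assume that there exists $n_0$ such that $$\theta \left( \log\left(1+\frac{n}{\theta}\right) - 1 + \frac{\theta}{n+\theta} \right) + \frac{n}{2(\theta+n)} - 1 >0$$ for all $n\ge n_0$. Then for all $n\ge n_0$, $$\| F_{n,\theta} - \Phi \|_\infty \leq C \gamma_1,$$ where $$\gamma_1 = \frac{ \theta\left\{ \log\left( 1+ \frac{n}{\theta} \right) - \frac{5}{3} + \frac{3\theta}{n+\theta} - \frac{2\theta^2}{(n+\theta)^2} + \frac{2\theta^3}{3(n+\theta)^3} \right\} + 4 + \frac{n}{n+\theta}}{\left\{ \theta \left( \log\left(1+\frac{n}{\theta}\right) - 1 + \frac{\theta}{n+\theta} \right) + \frac{n}{2(\theta+n)} - 1 \right\}^{3/2}}.$$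
   Context: For $\theta>0$ and a positive integer $n$, let $K=K_{n,\theta}$ be a random variable with ${\rm P}(K=x)=\bar{s}(n,x)\theta^x/(\theta)_n$ for $x=1,\ldots,n$, where $(\theta)_n=\theta(\theta+1)\cdots(\theta+n-1)$ and $\bar{s}(n,x)$ is the coefficient of $\theta^x$ in $(\theta)_n$ viewed as a polynomial in $\theta$. Let $\mu_0={\rm E}[K]=\theta\sum_{i=1}^n \frac{1}{\theta+i-1}$ and $\sigma_0^2={\rm var}(K)=\theta\sum_{i=1}^n\frac{i-1}{(\theta+i-1)^2}$. $F_{n,\theta}$ is the distribution function of $X_{n,\theta}=(K-\mu_0)/\sigma_0$, $\Phi$ is the standard normal distribution function, and $\|f\|_\infty=\sup_{x\in\mathbb{R}}|f(x)|$. The parameter $\theta$ may depend on $n$ and is assumed to be nondecreasing in $n$ (constant $\theta$ allowed). *)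

(* Defs.v *)
From HB Require Import structures.
From mathcomp Require Import all_boot all_order all_algebra.
From mathcomp Require Import all_classical all_reals all_analysis measurable_realfun.

Set Implicit Arguments.
Unset Strict Implicit.
Unset Printing Implicit Defensive.

Import Order.TTheory GRing.Theory Num.Theory.
Import numFieldNormedType.Exports.

Local Open Scope classical_set_scope.
Local Open Scope ring_scope.

(* (t)_n = t (t + 1) ... (t + n - 1), over an arbitrary ring so that it can be
   evaluated both at a real number and at the indeterminate 'X. *)
Definition rising_factorial (A : nzRingType) (t : A) (n : nat) : A :=
  \prod_(i < n) (t + i%:R).

(* Coefficient of t^x in (t)_n viewed as a polynomial in t: the unsigned
   Stirling number of the first kind. *)
Definition sbar (R : realType) (n x : nat) : R :=
  (rising_factorial ('X : {poly R}) n)`_x.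

(* The masses sum to 1 over 1 <= x <= n, so K takes no other value with
   positive probability. *)
Definition has_K_law d (T : measurableType d) (R : realType)
    (P : probability T R) (K : {RV P >-> R}) (n : nat) (theta : R) : Prop :=
  forall x : nat, (1 <= x <= n)%N ->
    P [set w | K w = x%:R]
    = (sbar R n x * theta ^+ x / rising_factorial theta n)%:E.

Section standardization.
Context d (T : measurableType d) (R : realType) (P : probability T R).

Definition mean (K : {RV P >-> R}) : R := fine ('E_P[K])%E.

Definition std_dev (K : {RV P >-> R}) : R := Num.sqrt (fine ('V_P[K])%E).

Definition standardize (K : {RV P >-> R}) (w : T) : R :=
  (K w - mean K) / std_dev K.

Variable K : {RV P >-> R}.

Let measurable_standardize : measurable_fun [set: T] (standardize K).
Proof. by apply: measurable_funM => //; exact: measurable_funB. Qed.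

HB.instance Definition _ :=
  isMeasurableFun.Build _ _ _ _ (standardize K) measurable_standardize.

End standardization.

Definition standardized_cdf d (T : measurableType d) (R : realType)
    (P : probability T R) (K : {RV P >-> R}) (x : R) : \bar R :=
  cdf (standardize K : {RV P >-> R}) x.

Definition Phi (R : realType) (x : R) : \bar R := normal_prob 0 1 `]-oo, x].

(* Here the pointwise supremum, unlike 'N_+oo, which is an essential one. *)
Definition sup_norm (R : realType) (f : R -> \bar R) : \bar R :=
  ereal_sup [set `|f x|%E | x in [set: R]].

Definition var_bound (R : realType) (n : nat) (theta : R) : R :=
  theta * (ln (1 + n%:R / theta) - 1 + theta / (n%:R + theta))
  + n%:R / (2 * (theta + n%:R)) - 1.

Definition gamma1 (R : realType) (n : nat) (theta : R) : R :=
  (theta * (ln (1 + n%:R / theta) - 5 / 3 + 3 * theta / (n%:R + theta)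
            - 2 * theta ^+ 2 / (n%:R + theta) ^+ 2
            + 2 * theta ^+ 3 / (3 * (n%:R + theta) ^+ 3))
   + 4 + n%:R / (n%:R + theta))
  / (var_bound n theta `^ (3 / 2)).

(* Main.v *)
(** The probability generating function of K factors as the product over i < n of
    (i + theta X) / (theta + i), so K is a sum of independent Bernoulli variables with
    success probabilities p_i = theta / (theta + i).  Let B^2 be its variance and
    tau the average of |1 - 2 p_i| for the weights p_i (1 - p_i) / B^2.

    Stein's method is applied at the points z halfway between two atoms, so that the
    trapezoidal rule on each step of the lattice also holds across z.  Its error is at most
    an increment of the second derivative of the Stein solution, and Stein's identity turns
    the sum of these increments into a bounded expectation.  What remains is an error of at
    most tau / 2 * sup_k P(K_i = k) + (M(0) / 2 + 1) / (8 B^2), where M = Phi / phi and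
    K_i omits the i-th variable.  A Fourier argument over the
    roots of unity gives sup_k P(K_i = k) <= 1 / (2 B) + 5 / (16 B^3); reflection
    p_i -> 1 - p_i gives the lower bound, and passing from z to an arbitrary point costs
    0.205 / B.  By Jensen's inequality the total is at most 0.5591 (L + 3) / B^3, where L
    is the sum of the third absolute central moments (if B < 1, this exceeds 1).  Finally
    comparison of sums with integrals gives var_bound <= B^2, and shows that L + 3 is at
    most the numerator of gamma1. *)
From HB Require Import structures.
Require Import Defs.
From mathcomp Require Import all_boot all_order all_algebra all_solvable all_field.
From mathcomp Require Import all_classical all_reals all_analysis measurable_realfun.
From mathcomp Require Import complex ring lra.

Set Implicit Arguments.
Unset Strict Implicit.
Unset Printing Implicit Defensive.

Import Order.TTheory GRing.Theory Num.Theory.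
Import numFieldNormedType.Exports.

Local Open Scope classical_set_scope.
Local Open Scope ring_scope.

(** * Expectations against the coefficients of a polynomial *)

Section poly_expectation.
Context {R : comNzRingType}.
Implicit Types (g : {poly R}) (h : nat -> R).

(** When [g] is the probability generating function of a variable S, this is the expectation of [h]
    at S. *)
Definition pexp g h : R := \sum_(m < size g) g`_m * h m.

Lemma pexp_widen N g h : (size g <= N)%N -> pexp g h = \sum_(m < N) g`_m * h m.
Proof.
move=> gN; rewrite /pexp (big_ord_widen N (fun m => g`_m * h m)) //.
rewrite big_mkcond; apply: eq_bigr => i _; case: ltnP => // ?.
by rewrite nth_default // mul0r.
Qed.

Lemma pexpD g1 g2 h : pexp (g1 + g2) h = pexp g1 h + pexp g2 h.
Proof.
rewrite (pexp_widen h (size_polyD g1 g2)).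
rewrite (pexp_widen h (leq_maxl (size g1) (size g2))).
rewrite (pexp_widen h (leq_maxr (size g1) (size g2))) -big_split.
by apply: eq_bigr => i _; rewrite coefD mulrDl.
Qed.

Lemma pexp0 h : pexp 0 h = 0.
Proof. by rewrite /pexp size_poly0 big_ord0. Qed.

Lemma pexpZ c g h : pexp (c *: g) h = c * pexp g h.
Proof.
rewrite (pexp_widen h (size_scale_leq c g)) mulr_sumr.
by apply: eq_bigr => i _; rewrite coefZ mulrA.
Qed.

Lemma pexp_sum (I : finType) (P : pred I) (g : I -> {poly R}) h :
  pexp (\sum_(i | P i) g i) h = \sum_(i | P i) pexp (g i) h.
Proof. exact: (big_morph (pexp^~ h) (fun a b => pexpD a b h) (pexp0 h)). Qed.

Lemma pexpXM g h : pexp ('X * g) h = pexp g (fun m => h m.+1).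
Proof.
have sX : (size ('X * g)%R <= (size g).+1)%N.
  by rewrite (leq_trans (size_polyMleq _ _)) // size_polyX.
rewrite (pexp_widen h sX) big_ord_recl coefXM mul0r add0r.
by apply: eq_bigr => i _; rewrite coefXM.
Qed.

Lemma eq_pexp g h1 h2 : h1 =1 h2 -> pexp g h1 = pexp g h2.
Proof. by move=> e; apply: eq_bigr => i _; rewrite e. Qed.

Lemma pexp_funD g h1 h2 :
  pexp g (fun m => h1 m + h2 m) = pexp g h1 + pexp g h2.
Proof. by rewrite -big_split; apply: eq_bigr => i _; rewrite mulrDr. Qed.

Lemma pexp_funZ c g h : pexp g (fun m => c * h m) = c * pexp g h.
Proof. by rewrite mulr_sumr; apply: eq_bigr => i _; rewrite mulrCA. Qed.

Lemma pexp_funB g h1 h2 :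
  pexp g (fun m => h1 m - h2 m) = pexp g h1 - pexp g h2.
Proof. by rewrite -sumrB; apply: eq_bigr => i _; rewrite mulrBr. Qed.

Lemma pexp1 g : pexp g (fun=> 1) = g.[1].
Proof. by rewrite horner_coef; apply: eq_bigr => i _; rewrite expr1n. Qed.

(** On coefficients, X d/dX is multiplication by the index; this lets Stein's identity come from the
    derivative of a product. *)
Lemma pexpXderiv g h : pexp ('X * g^`()) h = pexp g (fun m => m%:R * h m).
Proof.
have sX : (size ('X * g^`())%R <= (size g).+1)%N.
  rewrite (leq_trans (size_polyMleq _ _)) // size_polyX /= add1n ltnS.
  have [->|/lt_size_deriv/ltnW //] := eqVneq g 0; by rewrite deriv0.
rewrite (pexp_widen h sX) (pexp_widen _ (leqnSn (size g))).
apply: eq_bigr => -[[|i] ?] _ /=; rewrite coefXM /= ?mul0r ?mulr0 //.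
by rewrite coef_deriv !mulrnAl mul1r mulrnAr.
Qed.

Lemma deriv_prod (I : finType) (P : pred I) (F : I -> {poly R}) :
  (\prod_(i | P i) F i)^`()
  = \sum_(i | P i) (F i)^`() * \prod_(j | P j && (j != i)) F j.
Proof.
have [n] := ubnP #|P|; elim: n P => // n IH P; rewrite ltnS => Pn.
have [/existsP[i Pi]|/existsPn P0] := boolP [exists i, P i]; last first.
  by rewrite !big_pred0 ?derivC // => i; exact/negbTE/P0.
rewrite (bigD1 i) // [RHS](bigD1 i) //= derivM; congr (_ + _).
rewrite IH; last first.
  rewrite (leq_trans _ Pn) // (cardD1 i P) [i \in P]Pi ltnS.
  by apply/subset_leq_card/fintype.subsetP => j; rewrite !inE => /andP[Pj ->].
rewrite mulr_sumr; apply: eq_bigr => k /andP[Pk ki].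
rewrite mulrCA; congr (_ * _); rewrite [RHS](bigD1 i) ?Pi 1?eq_sym //=.
by congr (_ * _); apply: eq_bigl => j; rewrite andbAC.
Qed.

End poly_expectation.

(** * Sums of independent Bernoulli variables and Stein's identity *)

Section poisson_binomial.
Context {R : realFieldType} {I : finType}.
Variable p : I -> R.
Implicit Types P : pred I.

(** [bern a] generates a Bernoulli variable, so [pbin P] generates the sum of the independent ones
    indexed by [P]. The predicate makes it possible to omit one of them. *)
Definition bern (a : R) : {poly R} := (1 - a)%:P + a *: 'X.
Definition pbin P : {poly R} := \prod_(i | P i) bern (p i).

Lemma pbin_rem P i : P i -> pbin P = bern (p i) * pbin (fun j => P j && (j != i)).
Proof. by move=> Pi; rewrite /pbin (bigD1 i). Qed.

Lemma pexp_bernM a g h :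
  pexp (bern a * g) h = (1 - a) * pexp g h + a * pexp g (fun m => h m.+1).
Proof.
by rewrite mulrDl mul_polyC -scalerAl pexpD !pexpZ pexpXM.
Qed.

(** Let S_i omit the i-th variable from the sum S. The product rule yields the terms [p i] E h(S_i +
    1). Conditioning on the i-th variable splits [p i] E h(S) over S_i and S_i + 1, and the
    difference has the common factor [p i * (1 - p i)]. *)
Lemma pbin_stein P h :
  pexp (pbin P) (fun m => (m%:R - \sum_(i | P i) p i) * h m) =
  \sum_(i | P i) p i * (1 - p i) *
     (pexp (pbin (fun j => P j && (j != i))) (fun m => h m.+1)
      - pexp (pbin (fun j => P j && (j != i))) h).
Proof.
under eq_pexp do rewrite mulrBl.
rewrite pexp_funB pexp_funZ -pexpXderiv deriv_prod mulr_sumr pexp_sum.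
rewrite mulr_suml -sumrB; apply: eq_bigr => i Pi.
rewrite (pbin_rem Pi) pexp_bernM derivD derivC derivZ derivX add0r.
rewrite -/(pbin _) alg_polyC mul_polyC -scalerAr pexpZ pexpXM; ring.
Qed.

Hypothesis p01 : forall i, 0 <= p i <= 1.

Lemma pbin_coef_ge0 P m : 0 <= (pbin P)`_m.
Proof.
rewrite /pbin; elim/big_rec: _ m => [m|i g Pi IH m]; first by rewrite coef1 ler0n.
rewrite mulrDl mul_polyC -scalerAl coefD !coefZ coefXM.
have /andP[p0 p1] := p01 i; rewrite addr_ge0 // mulr_ge0 ?subr_ge0 //.
by case: ifP.
Qed.

Lemma pbin_mass P : (pbin P).[1] = 1.
Proof.
rewrite /pbin horner_prod big1 // => i _.
by rewrite /bern !hornerE subrK.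
Qed.

Lemma pexp_pbin_le P h1 h2 : (forall m, h1 m <= h2 m) ->
  pexp (pbin P) h1 <= pexp (pbin P) h2.
Proof. by move=> h; apply: ler_sum => i _; rewrite ler_wpM2l ?pbin_coef_ge0. Qed.

Lemma pexp_pbin_cst P c : pexp (pbin P) (fun=> c) = c.
Proof.
rewrite -[RHS]mulr1 -(pbin_mass P) -pexp1 -pexp_funZ.
by apply: eq_pexp => m; rewrite mulr1.
Qed.

Lemma pbin_mean P :
  pexp (pbin P) (fun m => m%:R - \sum_(i | P i) p i) = 0.
Proof.
under eq_pexp do rewrite -[_ - _]mulr1.
by rewrite (pbin_stein P (fun=> 1)) big1 // => i _; rewrite subrr mulr0.
Qed.

Lemma pbin_var P :
  pexp (pbin P) (fun m => (m%:R - \sum_(i | P i) p i) ^+ 2)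
  = \sum_(i | P i) p i * (1 - p i).
Proof.
under eq_pexp do rewrite expr2.
rewrite (pbin_stein P (fun m => m%:R - _)); apply: eq_bigr => i _.
rewrite -pexp_funB (_ : pexp _ _ = 1) ?mulr1 //.
rewrite -[RHS](pexp_pbin_cst (fun j => P j && (j != i)) 1).
apply: eq_pexp => m; rewrite /= -natr1; ring.
Qed.

End poisson_binomial.

(** * Roots of unity: discrete Fourier inversion and Parseval's identity *)

(** ['X^n - 1] is separable in characteristic zero, so it has n distinct roots, and one of them must
    be primitive. *)
Lemma closed_prim_root_exists (F : numClosedFieldType) n :
  (n > 0)%N -> exists z : F, n.-primitive_root z.
Proof.
move=> n_gt0; have [r] := closed_field_poly_normal ('X^n - 1 : {poly F}).
rewrite (monicP _) ?monicXnsubC // scale1r => Dp.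
have rn1: all n.-unity_root r by apply/allP=> z; rewrite -root_prod_XsubC -Dp.
have sz_r: (n < (size r).+1)%N.
  by rewrite -(size_prod_XsubC r id) -Dp size_XnsubC.
have [|z] := hasP (has_prim_root n_gt0 rn1 _ sz_r); last by exists z.
by rewrite -separable_prod_XsubC -Dp separable_Xn_sub_1 // pnatr_eq0 -lt0n.
Qed.

Section unit_circle.
Context {R : rcfType}.
Local Notation C := R[i].
Implicit Types (z : C).

Lemma sum_prim_root (N : nat) z (k : nat) : N.-primitive_root z ->
  \sum_(l < N) (z ^+ l) ^+ k = if (N %| k)%N then N%:R else 0.
Proof.
move=> zN; under eq_bigr do rewrite exprAC.
rewrite (prim_order_dvd zN); have [->|zk] := eqVneq (z ^+ k) 1.
  by under eq_bigr do rewrite expr1n; rewrite sumr_const card_ord.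
apply: (@mulfI _ (z ^+ k - 1)); first by rewrite subr_eq0.
by rewrite mulr0 -subrX1 exprAC (prim_expr_order zN) expr1n subrr.
Qed.

Lemma norm_prim_root N z : N.-primitive_root z -> `|z| = 1.
Proof.
move=> zN; apply: (@pexpIrn _ N) => //; rewrite ?nnegrE ?(prim_order_gt0 zN) //.
by rewrite -normrX prim_expr_order // normr1 expr1n.
Qed.

Lemma coef_dft (g : {poly C}) N z (k : nat) : N.-primitive_root z ->
  (size g <= N)%N -> (k < N)%N ->
  N%:R * g`_k = \sum_(l < N) g.[z ^+ l] * (z ^+ l) ^- k.
Proof.
move=> zN gN kN; have z0 : z != 0.
  by rewrite (prim_root_eq0 zN) -lt0n (leq_trans _ kN).
under eq_bigr do rewrite (horner_coef_wide _ gN) mulr_suml.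
rewrite exchange_big /= (bigD1 (Ordinal kN)) //= [X in _ + X]big1 ?addr0 => [|j jk].
  under eq_bigr do rewrite mulfK ?expf_neq0 //.
  by rewrite sumr_const card_ord mulr_natl.
(* With [N - k] in place of [- k], the inner sum runs over powers with the natural exponent
   [j + (N - k)], which [N] divides only for [j = k]. *)
have wk (l : 'I_N) : (z ^+ l) ^- k = (z ^+ l) ^+ (N - k).
  apply: (@mulfI _ ((z ^+ l) ^+ k)); first by rewrite !expf_neq0.
  rewrite divff ?expf_neq0 // -exprD subnKC 1?ltnW //.
  by rewrite exprAC (prim_expr_order zN) expr1n.
under eq_bigr do rewrite wk -mulrA -exprD.
rewrite -mulr_sumr (sum_prim_root _ zN) addnBA 1?ltnW // ifN ?mulr0 //.
apply: contra jk; rewrite -eqn_mod_dvd; last by rewrite ltnW // ltn_addl.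
by rewrite modnDr !modn_small.
Qed.

(** Conjugation inverts roots of unity: once one factor is expanded and conjugated, the inversion
    formula evaluates the sum over the other. *)
Lemma parseval (g : {poly C}) N z : N.-primitive_root z -> (size g <= N)%N ->
  \sum_(l < N) `|g.[z ^+ l]| ^+ 2 = N%:R * \sum_(k < N) `|g`_k| ^+ 2.
Proof.
move=> zN gN.
have E l : `|g.[z ^+ l]| ^+ 2 =
    \sum_(k < N) (g`_k)^* * (g.[z ^+ l] * (z ^+ l) ^- k).
  rewrite normCK; under eq_bigr do rewrite mulrCA.
  rewrite -mulr_sumr (horner_coef_wide _ gN) rmorph_sum /=.
  congr (_ * _); apply: eq_bigr => k _; rewrite rmorphM rmorphXn /=.
  congr (_ * _); rewrite -exprVn; congr (_ ^+ _).
  by rewrite invC_norm normrX (norm_prim_root zN) !expr1n invr1 mul1r rmorphXn.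
under eq_bigr do rewrite E.
rewrite exchange_big mulr_sumr; apply: eq_bigr => k _ /=.
by rewrite -mulr_sumr -(coef_dft zN gN) // normCKC mulrCA.
Qed.

End unit_circle.

(** * Partial sums of differentiated geometric series *)

Section series.
Context {R : realFieldType}.

Lemma sum_sqr_geom_le (x : R) N : 0 <= x < 1 ->
  \sum_(j < N) j.+1%:R ^+ 2 * x ^+ j <= (1 + x) / (1 - x) ^+ 3.
Proof.
move=> /andP[x0 x1]; rewrite ler_pdivlMr ?exprn_gt0 ?subr_gt0 //.
(* The truncation error has a closed form of visible sign, which induction confirms. *)
have -> : (\sum_(j < N) j.+1%:R ^+ 2 * x ^+ j) * (1 - x) ^+ 3
  = 1 + x - x ^+ N * ((N%:R + 1 - N%:R * x) ^+ 2 + x).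
  elim: N => [|N IH]; first by rewrite big_ord0; ring.
  rewrite big_ord_recr /= mulrDl IH [x ^+ N.+1]exprS -natr1; ring.
by rewrite gerBl mulr_ge0 ?exprn_ge0 // addr_ge0 ?sqr_ge0.
Qed.

Lemma sum_geom_deriv (A : comNzRingType) (x : A) N :
  (1 - x) ^+ 2 * (\sum_(j < N) j.+1%:R * x ^+ j)
  = 1 - N.+1%:R * x ^+ N + N%:R * x ^+ N.+1.
Proof.
elim: N => [|N IH]; first by rewrite big_ord0; ring.
by rewrite big_ord_recr /= mulrDr IH [x ^+ N.+2]exprS [x ^+ N.+1]exprS -!natr1; ring.
Qed.
End series.

(** * A uniform bound on the point masses *)

Section local_bound.
Context {R : realType} {I : finType}.
Variable p : I -> R.
Hypothesis p01 : forall i, 0 <= p i <= 1.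

Lemma geom_decay (r e : R) (N0 : nat) : 0 <= r < 1 -> 0 < e ->
  exists2 N, (N0 < N)%N & (2 * N%:R + 1) * r ^+ N <= e.
Proof.
move=> /andP[r0 r1] e0.
pose t := 1 - r; have t0 : 0 < t by rewrite subr_gt0.
(* Since [2 N + 1 <= 3 N] and [(1 + t N / 2)^2 >= t^2 N^2 / 4], this threshold makes
   [(2 N + 1) (1 + t N / 2)^-2] at most [e]. *)
pose N := maxn N0.+1 (Num.truncn (12 / (t ^+ 2 * e))).+1.
exists N; first by rewrite leq_max leqnn.
have N1 : 1 <= N%:R :> R by rewrite ler1n leq_max.
have Ne : 12 / (t ^+ 2 * e) <= N%:R.
  rewrite (le_trans (ltW (truncnS_gt _))) // ler_nat leq_max leqnn orbT //.
have te : 0 < t ^+ 2 * e by rewrite mulr_gt0 // exprn_gt0.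
have rN : r ^+ N <= (1 + t * N%:R / 2) ^- 2.
  have : r <= expR (- t) by rewrite (le_trans _ (expR_ge1Dx _)) // /t; lra.
  move=> /(lerXn2r N); rewrite nnegrE r0 nnegrE expR_ge0 => /(_ isT isT) /le_trans.
  apply; rewrite -expRM_natr mulNr expRN lef_pV2 ?posrE ?expR_gt0 //; last first.
    by rewrite exprn_gt0 // addr_gt0 // !mulr_gt0 ?(lt_le_trans _ N1).
  rewrite {2}(splitr (t * N%:R)) expRD -expr2 lerXn2r ?nnegrE ?expR_ge0 //.
    by rewrite addr_ge0 // !mulr_ge0 // ltW.
  by rewrite expR_ge1Dx.
apply: (le_trans (ler_wpM2l _ rN)); first by rewrite addr_ge0 // mulr_ge0.
rewrite ler_pdivrMr; last first.
  by rewrite exprn_gt0 // addr_gt0 // !mulr_gt0 ?(lt_le_trans _ N1).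
move: Ne; rewrite ler_pdivrMr // => Ne.
have : 12 * N%:R <= N%:R * (t ^+ 2 * e) * N%:R by rewrite ler_wpM2r.
have : 0 <= e * t * N%:R by rewrite !mulr_ge0 // ltW.
nra.
Qed.

Let v (P : pred I) := \sum_(i | P i) p i * (1 - p i).

(** With [c = 1 - Re w], each factor has squared modulus [1 - 2 p (1 - p) c], at most the
    exponential of [- 2 p (1 - p) c]. The product is thus at most exp(- 2 v c), and exp(2 v c) is at
    least [(1 + v c / 2)^4]. Such a rational majorant can be summed exactly. *)
Lemma norm_pbin (P : pred I) (w : R[i]) : `|w| = 1 ->
  `|(map_poly (real_complex R) (pbin p P)).[w]|
    <= ((1 + v P * (1 - complex.Re w) / 2) ^- 2)%:C%C.
Proof.
move=> w1.
have w2 : (complex.Re w) ^+ 2 + (complex.Im w) ^+ 2 = 1.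
  by apply: (@complexI R); rewrite add_Re2_Im2 w1 expr1n.
have w21 : complex.Re w ^+ 2 <= 1 by rewrite -w2 lerDl sqr_ge0.
pose c := 1 - complex.Re w; have c0 : 0 <= c by rewrite /c; nra.
have c2 : c <= 2.
  have : `|complex.Re w| <= 1.
    by rewrite -(@ler_pXn2r _ 2) ?nnegrE // real_normK ?num_real ?expr1n.
  by rewrite ler_norml /c => /andP[? _]; lra.
have v0 : 0 <= v P.
  by apply: sumr_ge0 => i _; have /andP[? ?] := p01 i; rewrite mulr_ge0 // subr_ge0.
have d0 : 0 < 1 + v P * c / 2 by rewrite ltr_pwDl // !mulr_ge0.
have E : `|(map_poly (real_complex R) (pbin p P)).[w]| ^+ 2 =
    (\prod_(i | P i) (1 - 2 * (p i * (1 - p i)) * c))%:C%C.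
  rewrite /pbin rmorph_prod horner_prod normr_prod -prodrXl rmorph_prod /=.
  apply: eq_bigr => i _; rewrite /bern rmorphD /= map_polyC /= linearZ /= map_polyX.
  rewrite !hornerE -add_Re2_Im2; congr (_%:C)%C.
  case: w w1 w2 @c c0 c2 d0 w21 => a b /= _ ab _ _ _ _.
  apply: subr0_eq; transitivity (p i ^+ 2 * (a ^+ 2 + b ^+ 2 - 1)); first ring.
  by rewrite ab subrr mulr0.
have le : \prod_(i | P i) (1 - 2 * (p i * (1 - p i)) * c) <= ((1 + v P * c / 2) ^- 2) ^+ 2.
  apply: (@le_trans _ _ (\prod_(i | P i) expR (- (2 * (p i * (1 - p i)) * c)))).
    apply: ler_prod => i _; rewrite expR_ge1Dx andbT.
    have /andP[? ?] := p01 i.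
    have : p i * (1 - p i) <= 1 / 4 by have := sqr_ge0 (p i - 1 / 2); nra.
    have : 0 <= p i * (1 - p i) by rewrite mulr_ge0 // subr_ge0.
    move: (p i * _) => y; nra.
  rewrite -expR_sum sumrN -mulr_suml -mulr_sumr -/(v P) expRN -exprVn -exprM exprVn.
  rewrite lef_pV2 ?posrE ?expR_gt0 ?exprn_gt0 //.
  rewrite (_ : 2 * v P * c = (v P * c / 2) * 4%:R); last by field.
  rewrite expRM_natr lerXn2r ?nnegrE ?expR_ge0 ?(ltW d0) // expR_ge1Dx //.
rewrite -(@ler_pXn2r _ 2) ?nnegrE ?normr_ge0 ?ler0c ?invr_ge0 ?exprn_ge0 ?(ltW d0) //.
by rewrite E -rmorphXn /= lecR.
Qed.


(* On the unit circle the generating function is at most [(1 + v c / 2)^-2] with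
   [c = 1 - Re w], and [1 + v c / 2 = kap * |1 - r w|^2].  Up to the factor [1 - e],
   [S] is the inverse of [(1 - r w)^2], so Parseval's identity for [S] bounds the
   average of this majorant over the [N]-th roots of unity. *)
Lemma pbin_coef_le_aux (P : pred I) k (s : R) N :
  1 <= s -> s ^+ 2 = 1 + v P -> (k < N)%N -> (size (pbin p P) <= N)%N ->
  let r := (s - 1) / (s + 1) in let e := (2 * N%:R + 1) * r ^+ N in e <= 1 ->
  (pbin p P)`_k * (1 - e) ^+ 2 <= (s ^+ 2 + 1) / (2 * s ^+ 3).
Proof.
move=> s1 sv kN gN r e e1.
have s0 : 0 < s by rewrite (lt_le_trans _ s1).
have s10 : 0 < s + 1 by rewrite addr_gt0.
have r0 : 0 <= r by rewrite divr_ge0 ?subr_ge0 // ltW.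
have r1 : r < 1 by rewrite /r ltr_pdivrMr //; lra.
pose kap := (s + 1) ^+ 2 / 4; have kap0 : 0 < kap by rewrite divr_gt0 ?exprn_gt0.
have N0 : (0 < N)%N by rewrite (leq_trans _ kN).
have [z zN] := @closed_prim_root_exists R[i] N N0.
pose S : {poly R[i]} := \poly_(j < N) (j.+1%:R * r ^+ j)%:C%C.
pose D l := 1 + v P * (1 - complex.Re (z ^+ l)) / 2.
have w1 l : `|z ^+ l| = 1 by rewrite normrX (norm_prim_root zN) expr1n.
have step l : ((D l ^- 2 * (1 - e) ^+ 2)%:C <= (kap ^- 2)%:C * `|S.[z ^+ l]| ^+ 2)%C.
  set w := z ^+ l.
  have w2 : complex.Re w ^+ 2 + complex.Im w ^+ 2 = 1.
    by apply: (@complexI R); rewrite add_Re2_Im2 w1 expr1n.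
  have Dn : `|1 - r%:C%C * w| ^+ 2 = (D l / kap)%:C%C.
    rewrite -add_Re2_Im2; congr (_%:C)%C; rewrite /D -/w.
    move: w w2 => [a b] /= ab.
    rewrite ?mulr0 ?mul0r ?add0r ?addr0 ?subr0 ?sub0r.
    have -> : v P = s ^+ 2 - 1 by rewrite sv; ring.
    apply: subr0_eq; transitivity (r ^+ 2 * (a ^+ 2 + b ^+ 2 - 1)).
      by rewrite /r /kap; field; rewrite gt_eqF.
    by rewrite ab subrr mulr0.
  have wN : w ^+ N = 1 by rewrite exprAC (prim_expr_order zN) expr1n.
  (* As [w ^+ N = 1], the truncation terms become multiples of powers of [r], of total modulus at
     most [e]. *)
  have SE : (1 - r%:C%C * w) ^+ 2 * S.[w]
      = 1 - (N.+1%:R * r ^+ N)%:C%C + (N%:R * r ^+ N.+1)%:C%C * w.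
    rewrite (@horner_coef_wide _ N) ?size_poly //.
    transitivity ((1 - r%:C%C * w) ^+ 2 * \sum_(j < N) j.+1%:R * (r%:C%C * w) ^+ j).
      congr (_ * _); apply: eq_bigr => j _; rewrite coef_poly ltn_ord.
      by rewrite rmorphM rmorph_nat rmorphXn /= exprMn mulrA.
    rewrite sum_geom_deriv ![(_%:R * r ^+ _)%:C%C]rmorphM !rmorph_nat !rmorphXn /=.
    by rewrite !exprSr exprMn wN; ring.
  have lo : ((1 - e)%:C <= `|(1 - r%:C * w) ^+ 2 * S.[w]|)%C.
    rewrite SE -addrA.
    set q := (X in `|1 + X|).
    have qe : `|q| <= e%:C%C.
      rewrite (le_trans (ler_normD _ _)) // normrN normrM w1 mulr1.
      rewrite !ger0_norm ?ler0c ?mulr_ge0 ?ler0n ?exprn_ge0 // -rmorphD lecR /e.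
      have : r ^+ N.+1 <= r ^+ N by rewrite ler_wiXn2l // ltW.
      have : 0 <= r ^+ N by rewrite exprn_ge0.
      have : 0 <= N%:R :> R by [].
      rewrite -natr1; nra.
    have := lerB_normD 1 q; rewrite normr1; apply: le_trans.
    by rewrite rmorphB rmorph1 lerD2l lerN2.
  have D0 : 0 < D l.
    have v0 : 0 <= v P by have := sv; nra.
    have : complex.Re w <= 1.
      rewrite (le_trans (ler_norm _)) // -(@ler_pXn2r _ 2) ?nnegrE // real_normK ?num_real //.
      by rewrite expr1n -w2 lerDl sqr_ge0.
    by rewrite /D -/w => ?; rewrite ltr_pwDl // !mulr_ge0 // subr_ge0.
  have lo2 : (((1 - e) ^+ 2)%:C <= ((D l / kap) ^+ 2)%:C * `|S.[w]| ^+ 2)%C.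
    rewrite !rmorphXn /= -Dn -(normrX _ (1 - r%:C%C * w)) -exprMn -normrM.
    rewrite lerXn2r ?nnegrE ?normr_ge0 ?ler0c ?subr_ge0 //.
  have Dk : (D l / kap) ^+ 2 != 0 by rewrite expf_neq0 // gt_eqF // divr_gt0.
  have DC : (0 < (D l ^+ 2)%:C :> R[i])%C by rewrite (ltcR 0) exprn_gt0.
  rewrite -(ler_pM2l DC).
  rewrite -rmorphM mulrA divff ?mul1r ?expf_neq0 ?(gt_eqF D0) //.
  by rewrite mulrA -rmorphM /= -exprVn -exprMn.
have up : ((N%:R * (pbin p P)`_k)%:C <= \sum_(l < N) (D l ^- 2)%:C)%C.
  rewrite -[X in X <= _]ger0_norm; last first.
    by rewrite ler0c mulr_ge0 ?pbin_coef_ge0.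
  pose G := map_poly (real_complex R) (pbin p P).
  have GN : (size G <= N)%N by rewrite size_map_poly.
  rewrite rmorphM rmorph_nat /= -[((pbin p P)`_k)%:C%C](coef_map (real_complex R)).
  rewrite (coef_dft zN GN kN) (le_trans (ler_norm_sum _ _ _)) //.
  apply: ler_sum => i _.
  by rewrite normrM normfV normrX w1 expr1n invr1 mulr1 norm_pbin.
have : ((N%:R * ((pbin p P)`_k * (1 - e) ^+ 2))%:C <=
   (N%:R * (kap ^- 2 * ((1 + r ^+ 2) / (1 - r ^+ 2) ^+ 3)))%:C)%C.
  rewrite mulrA rmorphM /= (le_trans (ler_wpM2r _ up)) ?ler0c ?sqr_ge0 //.
  rewrite mulr_suml.
  apply: (@le_trans _ _ (\sum_(l < N) (kap ^- 2)%:C%C * `|S.[z ^+ l]| ^+ 2)).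
    by apply: ler_sum => i _; rewrite -rmorphM; exact: step.
  rewrite -mulr_sumr (parseval zN) ?size_poly // mulrCA rmorphM rmorph_nat /=.
  rewrite ler_wpM2l ?ler0n // rmorphM /= ler_wpM2l ?ler0c ?invr_ge0 ?exprn_ge0 ?(ltW kap0) //.
  have -> : \sum_(j < N) `|S`_j| ^+ 2 = (\sum_(j < N) j.+1%:R ^+ 2 * (r ^+ 2) ^+ j)%:C%C.
    rewrite rmorph_sum; apply: eq_bigr => j _ /=; rewrite coef_poly ltn_ord.
    rewrite ger0_norm ?ler0c ?mulr_ge0 ?exprn_ge0 // -rmorphXn /=.
    by rewrite exprMn exprAC.
  by rewrite lecR sum_sqr_geom_le // sqr_ge0 expr_lt1.
rewrite lecR ler_pM2l ?ltr0n //; move/le_trans; apply.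
rewrite le_eqVlt; apply/orP; left; apply/eqP; rewrite /kap /r.
have ? : (s + 1) ^+ 2 - (s - 1) ^+ 2 != 0.
  by rewrite (_ : _ - _ = 4 * s) ?mulf_neq0 ?(gt_eqF s0) //; ring.
by field; rewrite ?(gt_eqF s0) ?(gt_eqF s10).
Qed.

(** This is the limit of large [N] in the previous bound. If the mass [g] exceeded [K], the error
    [e = (g - K) / (4 g)] would still leave [g (1 - e)^2 >= (g + K) / 2 > K]. *)
Lemma pbin_coef_le (P : pred I) k (s : R) :
  1 <= s -> s ^+ 2 = 1 + v P ->
  (pbin p P)`_k <= (s ^+ 2 + 1) / (2 * s ^+ 3).
Proof.
move=> s1 sv; set K := (X in _ <= X); set g := _`_k; rewrite leNgt; apply/negP => Kg.
have s0 : 0 < s by rewrite (lt_le_trans _ s1).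
have K0 : 0 <= K by rewrite divr_ge0 ?addr_ge0 ?mulr_ge0 ?exprn_ge0 ?ltW.
have g0 : 0 < g by apply: le_lt_trans Kg.
pose r := (s - 1) / (s + 1).
have r01 : 0 <= r < 1.
  rewrite divr_ge0 ?subr_ge0 //= ?addr_ge0 ?(ltW s0) // /r ltr_pdivrMr ?addr_gt0 //; lra.
pose e := (g - K) / (4 * g).
have e0 : 0 < e by rewrite divr_gt0 ?subr_gt0 ?mulr_gt0.
have [N kN eN] := geom_decay (maxn k (size (pbin p P))) r01 e0.
have e1 : e <= 1 by rewrite ler_pdivrMr ?mulr_gt0 //; nra.
have := @pbin_coef_le_aux P k s N s1 sv (leq_ltn_trans (leq_maxl _ _) kN)
  (leq_trans (leq_maxr _ _) (ltnW kN)) (le_trans eN e1).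
rewrite -/r -/K -/g; move: eN; move: (_ * r ^+ N) => x xe.
have ee : e * (4 * g) = g - K by rewrite divfK // mulf_neq0 ?gt_eqF.
nra.
Qed.

End local_bound.

(** * Monotonicity from the sign of a derivative *)

Section monotonicity.
Context {R : realType}.
Implicit Types f df : R -> R.

Lemma is_derive_continuous f df :
  (forall x : R, is_derive x 1 f (df x)) -> continuous f.
Proof.
by move=> fd x; apply/differentiable_continuous/derivable1_diffP; case: (fd x).
Qed.

Lemma is_derive_MVT f df a b : (forall x : R, is_derive x 1 f (df x)) -> a <= b ->
  exists2 c, a <= c <= b & f b - f a = df c * (b - a).
Proof.
move=> fd ab; have [|c] := @MVT_segment _ f df a b ab (fun x _ => fd x).
  by apply/continuous_subspaceT/(is_derive_continuous fd).
by rewrite in_itv /= => cab fE; exists c.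
Qed.

Lemma is_derive_ge0_le f df a b : (forall x : R, is_derive x 1 f (df x)) ->
  (forall x, a <= x <= b -> 0 <= df x) -> a <= b -> f a <= f b.
Proof.
move=> fd df0 ab; rewrite -subr_ge0; have [c cab ->] := is_derive_MVT fd ab.
by rewrite mulr_ge0 ?df0 // subr_ge0.
Qed.

Lemma is_derive_gt0_lt f df a b : (forall x : R, is_derive x 1 f (df x)) ->
  (forall x, 0 < df x) -> a < b -> f a < f b.
Proof.
move=> fd df0 ab; rewrite -subr_gt0; have [c cab ->] := is_derive_MVT fd (ltW ab).
by rewrite mulr_gt0 ?df0 // subr_gt0.
Qed.

End monotonicity.

(** * The standard normal density and distribution function *)

Section std_normal.
Context {R : realType}.

Definition npdf (x : R) : R := normal_pdf 0 1 x.
Definition ncdf (x : R) : R := fine (Phi x).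

Lemma npdfE x : npdf x = (Num.sqrt (2 * pi))^-1 * expR (- x ^+ 2 / 2).
Proof.
rewrite /npdf normal_pdfE ?oner_neq0 // /normal_peak /normal_fun subr0.
by rewrite expr1n mul1r mulr_natl.
Qed.

Lemma npdf_gt0 x : 0 < npdf x.
Proof.
by rewrite npdfE mulr_gt0 ?expR_gt0 // invr_gt0 sqrtr_gt0 mulr_gt0 ?pi_gt0.
Qed.

Lemma npdfN x : npdf (- x) = npdf x.
Proof. by rewrite !npdfE sqrrN. Qed.

Lemma is_derive_npdf (x : R) : is_derive x 1 npdf (- x * npdf x).
Proof.
rewrite (_ : npdf = fun x => (Num.sqrt (2 * pi))^-1 * expR (- x ^+ 2 / 2)); last first.
  by apply/funext => y; rewrite npdfE.
have d1 : is_derive x (1 : R) (fun y : R => - y ^+ 2 / 2) (- x).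
  by apply: is_derive_eq; rewrite /GRing.scale /=; field.
have d2 := @is_derive1_comp _ expR (fun y => - y ^+ 2 / 2) x _ _
   (is_derive_expR _) d1.
have := is_deriveZ (Num.sqrt (2 * pi))^-1 d2.
rewrite /GRing.scale /=; move=> d3; apply: is_derive_eq; rewrite /GRing.scale /=; ring.
Qed.

Lemma ncdfE x : Phi x = (ncdf x)%:E.
Proof. by rewrite fineK // fin_num_measure. Qed.

Lemma ncdf_ge0 x : 0 <= ncdf x.
Proof. by rewrite -lee_fin -ncdfE measure_ge0. Qed.

Lemma is_derive_ncdf (x : R) : is_derive x 1 ncdf (npdf x).
Proof.
have c : continuous npdf by exact: is_derive_continuous is_derive_npdf.
have i : lebesgue_measure.-integrable `]-oo, (x + 1)] (EFin \o npdf).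
  apply: (integrableS measurableT) => //; exact: integrable_normal_pdf.
have := @continuous_FTC1 R npdf -oo%O x (x + 1) _ i _ (c x).
rewrite ltrDl ltNyr => /(_ ltr01 isT) [d e].
have dP := derivableP d; apply: is_derive_eq.
by rewrite -derive1E.
Qed.

(** Under the normal law the identity is a random variable with distribution function [ncdf], so the
    general limits of distribution functions apply. *)
Let idR : measurableTypeR R -> R := idfun.

HB.instance Definition _ :=
  @isMeasurableFun.Build _ _ _ _ idR (@measurable_id _ _ setT).

Let cdf_idR : cdf (idR : {RV (normal_prob 0 1 : probability _ R) >-> R})
  = EFin \o ncdf.
Proof. by apply/funext => x; rewrite /= -ncdfE. Qed.

Lemma cvg_ncdfNy : ncdf x @[x --> -oo] --> (0 : R).
Proof.
have := cvg_cdfNy0 (idR : {RV (normal_prob 0 1 : probability _ R) >-> R}).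
by rewrite cdf_idR => /fine_cvg.
Qed.

Lemma cvg_ncdfy : ncdf x @[x --> +oo] --> (1 : R).
Proof.
have := cvg_cdfy1 (idR : {RV (normal_prob 0 1 : probability _ R) >-> R}).
by rewrite cdf_idR => /fine_cvg.
Qed.

(** [ncdf x + ncdf (- x)] has derivative zero, and its constant value is read off at +oo. *)
Lemma ncdfN x : ncdf (- x) = 1 - ncdf x.
Proof.
have d (y : R) : is_derive y 1 (fun y => ncdf y + ncdf (- y)) 0.
  have dn := is_derive_ncdf (- y).
  have dy := is_derive_ncdf y.
  have dN : is_derive y (1 : R) (fun y : R => ncdf (- y)) (npdf (- y) * -1).
    exact: (@is_derive1_comp _ ncdf -%R).
  by apply: is_derive_eq; rewrite npdfN mulrN1 subrr.
have cst y : ncdf y + ncdf (- y) = ncdf x + ncdf (- x).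
  wlog xy : x y / x <= y => [hw|].
    by have [/hw//|/ltW/hw/esym] := leP x y.
  apply/eqP; rewrite -subr_eq0; have [c _ ->] := is_derive_MVT d xy.
  by rewrite mul0r.
apply/eqP; rewrite eq_sym subr_eq addrC; apply/eqP.
have l1 : ncdf y + ncdf (- y) @[y --> +oo] --> (1 + 0 : R).
  apply: cvgD; first exact: cvg_ncdfy.
  by have := cvg_ncdfNy; rewrite cvgNy_compNP.
have l2 : ncdf y + ncdf (- y) @[y --> +oo] --> ncdf x + ncdf (- x).
  by under eq_fun do rewrite cst; exact: cvg_cst.
rewrite addr0 in l1; exact: (cvg_unique _ l1 l2).
Qed.

Lemma ncdf0 : ncdf 0 = 1 / 2.
Proof. have := ncdfN 0; rewrite oppr0; lra. Qed.

Lemma ncdf_le1 x : ncdf x <= 1.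
Proof. by rewrite -[x]opprK ncdfN gerBl ncdf_ge0. Qed.



(* From [- x^2 / 2 <= x + 1 / 2]. *)
Lemma npdf_le_expR x : npdf x <= 2 * expR x.
Proof.
rewrite npdfE; apply: (@le_trans _ _ (1 * expR (x + 1 / 2))).
  apply: ler_pM; rewrite ?invr_ge0 ?sqrtr_ge0 ?expR_ge0 //.
    rewrite invf_le1 ?sqrtr_gt0 ?mulr_gt0 ?pi_gt0 //.
    by rewrite -[leLHS]sqrtr1 ler_wsqrtr //; have := @pi_ge2 R; lra.
  by rewrite ler_expR; have := sqr_ge0 (x + 1); lra.
rewrite mul1r expRD mulrC ler_wpM2r ?expR_ge0 //.
rewrite -[1 / 2]opprK expRN -[leRHS]invrK lef_pV2 ?posrE ?expR_gt0 ?invr_gt0 //.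
by rewrite (le_trans _ (expR_ge1Dx _)) //; lra.
Qed.

(** [2 * expR y - ncdf y] is nondecreasing and, near -oo, at least [- e] for every [e > 0]. *)
Lemma ncdf_le_expR x : ncdf x <= 2 * expR x.
Proof.
have d (y : R) : is_derive y 1 (fun y => 2 * expR y - ncdf y) (2 * expR y - npdf y).
  have := is_derive_ncdf y => dy.
  by apply: is_derive_eq; rewrite /GRing.scale /=; ring.
have mono y : y <= x -> 2 * expR y - ncdf y <= 2 * expR x - ncdf x.
  by move=> yx; apply: (is_derive_ge0_le d _ yx) => z _; rewrite subr_ge0 npdf_le_expR.
rewrite -subr_ge0; apply/ler_addgt0Pr => e e0.
near (-oo : set_system R) => y.
have yx : y <= x by near: y; apply: nbhs_ninfty_le; exact: num_real.
rewrite -lerBlDr sub0r (le_trans _ (mono y yx)) //.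
have : ncdf y <= e.
  near: y; move/cvgrPdist_le : cvg_ncdfNy => /(_ e e0).
  by apply: filterS => t; rewrite sub0r normrN ger0_norm ?ncdf_ge0.
have := expR_ge0 y; lra.
Unshelve. all: by end_near. Qed.

Lemma cube_expR_small (e : R) x : 0 < e ->
  exists2 t : R, t < x & t < -1 /\ - t ^+ 3 * expR t <= e.
Proof.
(* The 256 is 4^4: [expR u >= (u / 4)^4] gives [u^3 / expR u <= 256 / u <= e]. *)
move=> e0; pose u := Num.max 2 (Num.max (1 - x) (256 / e)).
have [u2 ux ue] : [/\ 2 <= u, 1 - x <= u & 256 / e <= u].
  by rewrite /u !le_max !lexx !orbT.
exists (- u); first by lra.
split; first by lra.
have u0 : 0 < u by lra.
rewrite expRN (_ : - (- u) ^+ 3 = u ^+ 3); last ring.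
rewrite ler_pdivrMr ?expR_gt0 //.
have : (u / 4) ^+ 4 <= expR u.
  rewrite [in leRHS](_ : u = u / 4 * 4%:R); last by field.
  rewrite expRM_natr lerXn2r ?nnegrE ?expR_ge0 ?divr_ge0 ?(ltW u0) //.
  by rewrite (le_trans _ (expR_ge1Dx _)) // lerDr.
move=> /(ler_wpM2l (ltW e0)); apply: le_trans.
move: ue; rewrite ler_pdivrMr // => ue.
have -> : e * (u / 4) ^+ 4 = (u * e) * u ^+ 3 / 256 by field.
have : 0 <= u ^+ 3 by rewrite exprn_ge0 // ltW.
nra.
Qed.

End std_normal.

(** * Positivity of the derivatives of the Mills ratio *)

Section mills.
Context {R : realType}.

(* [mills x] is the ratio ncdf / npdf, i.e. the Mills ratio at [- x], and
   [mills1], [mills2] and [mills3] are its successive derivatives. *)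
Definition mills (x : R) : R := ncdf x / npdf x.
Definition mills1 (x : R) : R := 1 + x * mills x.
Definition mills2 (x : R) : R := mills x + x * mills1 x.
Definition mills3 (x : R) : R := 2 * mills1 x + x * mills2 x.

Lemma mills_ncdf x : mills x * npdf x = ncdf x.
Proof. by rewrite divfK // gt_eqF // npdf_gt0. Qed.

Lemma is_derive_mills (x : R) : is_derive x 1 mills (mills1 x).
Proof.
have n0 : npdf x != 0 by rewrite gt_eqF // npdf_gt0.
have d1 := is_derive_ncdf x.
have d2 := is_derive_npdf x.
have d3 := is_deriveV n0 d2.
rewrite /mills1 /mills; apply: is_derive_eq.
by rewrite /GRing.scale /=; field.
Qed.

Lemma is_derive_mills1 (x : R) : is_derive x 1 mills1 (mills2 x).
Proof.
have d1 := is_derive_mills x; rewrite /mills1 /mills2; apply: is_derive_eq.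
by rewrite /GRing.scale /=; ring.
Qed.

Lemma is_derive_mills2 (x : R) : is_derive x 1 mills2 (mills3 x).
Proof.
have d1 := is_derive_mills x; have d2 := is_derive_mills1 x.
rewrite /mills2 /mills3; apply: is_derive_eq.
by rewrite /GRing.scale /mills2 /=; ring.
Qed.

(** Multiplied by the density, the derivatives of the Mills ratio become successive antiderivatives
    of [ncdf] up to positive factors, so positivity passes from [ncdf] to [h1], [h2] and [h3] in
    turn. *)
Let h1 x := mills1 x * npdf x.
Let h2 x := mills2 x * npdf x.
Let h3 x := mills3 x * npdf x.

Let h1E x : h1 x = npdf x + x * ncdf x.
Proof. by rewrite /h1 -mills_ncdf /mills1; ring. Qed.

Let h2E x : h2 x = x * npdf x + (1 + x ^+ 2) * ncdf x.
Proof. by rewrite /h2 -mills_ncdf /mills2 /mills1; ring. Qed.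

Let h3E x : h3 x = (x ^+ 2 + 2) * npdf x + (x ^+ 3 + 3 * x) * ncdf x.
Proof. by rewrite /h3 -mills_ncdf /mills3 /mills2 /mills1; ring. Qed.

Let dh1 (x : R) : is_derive x 1 h1 (ncdf x).
Proof.
rewrite (_ : h1 = fun x => npdf x + x * ncdf x); last exact/funext/h1E.
have d1 := is_derive_ncdf x; have d2 := is_derive_npdf x.
by apply: is_derive_eq; rewrite /GRing.scale /=; ring.
Qed.

Let dh2 (x : R) : is_derive x 1 h2 (2 * h1 x).
Proof.
rewrite (_ : h2 = fun x => x * npdf x + (1 + x ^+ 2) * ncdf x); last exact/funext/h2E.
have d1 := is_derive_ncdf x; have d2 := is_derive_npdf x.
by apply: is_derive_eq; rewrite h1E /GRing.scale /=; ring.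
Qed.

Let dh3 (x : R) : is_derive x 1 h3 (3 * h2 x).
Proof.
rewrite (_ : h3 = fun x => (x ^+ 2 + 2) * npdf x + (x ^+ 3 + 3 * x) * ncdf x);
  last exact/funext/h3E.
have d1 := is_derive_ncdf x; have d2 := is_derive_npdf x.
by apply: is_derive_eq; rewrite h2E /GRing.scale /=; ring.
Qed.

Lemma ncdf_gt0 (x : R) : 0 < ncdf x.
Proof.
rewrite (le_lt_trans (ncdf_ge0 (x - 1))) //.
apply: (is_derive_gt0_lt is_derive_ncdf npdf_gt0); lra.
Qed.

(* The increasing function [h] is nonnegative because its lower bound tends to 0 at -oo. *)
Let gt0_of_derive (h dh : R -> R) : (forall x : R, is_derive x 1 h (dh x)) ->
  (forall x, 0 < dh x) -> (forall t, t < -1 -> 8 * t ^+ 3 * expR t <= h t) ->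
  forall x, 0 < h x.
Proof.
move=> hd dh0 hlo x.
have ge y : 0 <= h y.
  apply/ler_addgt0Pr => e e0.
  have [t ty [t1 te]] := cube_expR_small y (divr_gt0 e0 (ltr0Sn R 7)).
  have := is_derive_gt0_lt hd dh0 ty; have := hlo t t1.
  by move: te; rewrite ler_pdivlMr //; lra.
rewrite (le_lt_trans (ge (x - 1))) //; apply: (is_derive_gt0_lt hd dh0); lra.
Qed.

Let h1_gt0 x : 0 < h1 x.
Proof.
apply: (gt0_of_derive dh1 ncdf_gt0) => t t1; rewrite h1E.
have := npdf_gt0 t; have := ncdf_le_expR t; have := ncdf_gt0 t.
have := expR_gt0 t; move: (expR t) (ncdf t) (npdf t) => e c d e0 c0 ce d0.
have t3 : t ^+ 3 <= t by rewrite exprS; nra.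
have : t * (2 * e) <= t * c by rewrite ler_wnM2l //; lra.
have : t ^+ 3 * e <= t * e by rewrite ler_wpM2r // ltW.
have : 0 <= - t * e by rewrite mulr_ge0 ?ltW // oppr_gt0; lra.
lra.
Qed.

Let h2_gt0 x : 0 < h2 x.
Proof.
apply: (gt0_of_derive dh2) => [y|t t1]; first by rewrite mulr_gt0.
rewrite h2E.
have := npdf_gt0 t; have := npdf_le_expR t; have := ncdf_gt0 t.
have := expR_gt0 t; move: (expR t) (ncdf t) (npdf t) => e c d e0 c0 de d0.
have t3 : t ^+ 3 <= t by rewrite exprS; nra.
have : t * (2 * e) <= t * d by rewrite ler_wnM2l //; lra.
have : t ^+ 3 * e <= t * e by rewrite ler_wpM2r // ltW.
have : 0 <= - t * e by rewrite mulr_ge0 ?ltW // oppr_gt0; lra.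
have : 0 <= (1 + t ^+ 2) * c by rewrite mulr_ge0 ?addr_ge0 ?sqr_ge0 // ltW.
lra.
Qed.

Let h3_gt0 x : 0 < h3 x.
Proof.
apply: (gt0_of_derive dh3) => [y|t t1]; first by rewrite mulr_gt0.
rewrite h3E.
have := npdf_gt0 t; have := ncdf_le_expR t; have := ncdf_gt0 t.
have := expR_gt0 t; move: (expR t) (ncdf t) (npdf t) => e c d e0 c0 ce d0.
have t3 : t ^+ 3 <= t by rewrite exprS; nra.
have t30 : t ^+ 3 + 3 * t <= 0 by lra.
have : (t ^+ 3 + 3 * t) * (2 * e) <= (t ^+ 3 + 3 * t) * c by rewrite ler_wnM2l.
have : t ^+ 3 * e <= t * e by rewrite ler_wpM2r // ltW.
have : 0 <= - t * e by rewrite mulr_ge0 ?ltW // oppr_gt0; lra.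
have : 0 <= (t ^+ 2 + 2) * d by rewrite mulr_ge0 ?addr_ge0 ?sqr_ge0 // ltW.
lra.
Qed.

Lemma mills_gt0 x : 0 < mills x.
Proof. by rewrite divr_gt0 ?ncdf_gt0 ?npdf_gt0. Qed.

Lemma mills1_gt0 x : 0 < mills1 x.
Proof. by rewrite -(pmulr_lgt0 _ (npdf_gt0 x)); exact: h1_gt0. Qed.

Lemma mills2_gt0 x : 0 < mills2 x.
Proof. by rewrite -(pmulr_lgt0 _ (npdf_gt0 x)); exact: h2_gt0. Qed.

Lemma mills3_gt0 x : 0 < mills3 x.
Proof. by rewrite -(pmulr_lgt0 _ (npdf_gt0 x)); exact: h3_gt0. Qed.

Lemma mills_le x y : x <= y -> mills x <= mills y.
Proof. by apply: is_derive_ge0_le is_derive_mills _ => z _; rewrite ltW ?mills1_gt0. Qed.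

Lemma mills1_le x y : x <= y -> mills1 x <= mills1 y.
Proof. by apply: is_derive_ge0_le is_derive_mills1 _ => z _; rewrite ltW ?mills2_gt0. Qed.

Lemma mills2_le x y : x <= y -> mills2 x <= mills2 y.
Proof. by apply: is_derive_ge0_le is_derive_mills2 _ => z _; rewrite ltW ?mills3_gt0. Qed.

(** This makes the two branches of the Stein solution agree at [z]. *)
Lemma ncdf_mills_sym z : ncdf (- z) * mills z = ncdf z * mills (- z).
Proof. by rewrite /mills npdfN; ring. Qed.

Lemma mills0 : mills 0 = Num.sqrt (2 * pi) / 2.
Proof.
rewrite /mills ncdf0 npdfE expr0n oppr0 mul0r expR0 mulr1 invrK.
by field.
Qed.

End mills.

(** * Numerical constants of the normal law *)

Section numeric_bounds.
Context {R : realType}.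

(** The triple angle formula gives cos(pi / 3) = 1 / 2, and cos t >= 1 - t^2 / 2 then forces pi / 3
    >= 1. *)
Lemma pi_ge3 : 3 <= pi :> R.
Proof.
pose t : R := pi / 3; pose c := cos t.
have pi0 := @pi_gt0 R.
have c0 : 0 < c by apply: cos_gt0_pihalf; apply/andP; split; rewrite /t; lra.
have c3 : 4 * c ^+ 3 - 3 * c = -1.
  rewrite -cospi (_ : pi = t + t + t); last by rewrite /t; field.
  rewrite !(cosD, sinD) -/c (_ : sin t * _ + _ = 2 * c * sin t); last by ring.
  have s2 : sin t ^+ 2 = 1 - c ^+ 2 by rewrite sin2cos2.
  transitivity (c ^+ 3 - 3 * c * (sin t ^+ 2)); first by rewrite s2; ring.
  by ring.
have c12 : c = 1 / 2.
  have : (c + 1) * (2 * c - 1) ^+ 2 = 0.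
    by transitivity (4 * c ^+ 3 - 3 * c + 1); [ring | rewrite c3; ring].
  move/eqP; rewrite mulf_eq0 expf_eq0 /= => /orP[] /eqP ?; lra.
have dsin (y : R) : is_derive y 1 (fun y => y - sin y) (1 - cos y).
  by apply: is_derive_eq.
have sin_le (y : R) : 0 <= y -> sin y <= y.
  move=> y0; have : 0 - sin 0 <= y - sin y.
    by apply: (is_derive_ge0_le dsin _ y0) => z _; rewrite subr_ge0 cos_le1.
  by rewrite sin0 subrr subr_ge0.
have dcos (y : R) : is_derive y 1 (fun y => cos y + y ^+ 2 / 2) (y - sin y).
  by apply: is_derive_eq; rewrite /GRing.scale /=; field.
have : 1 <= c + t ^+ 2 / 2.
  have t0 : 0 <= t by rewrite /t; lra.
  have := is_derive_ge0_le dcos _ t0; rewrite cos0 expr0n mul0r addr0; apply.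
  by move=> z /andP[z0 _]; rewrite subr_ge0 sin_le.
rewrite c12 => h; rewrite leNgt; apply/negP => pi3.
have : t < 1 by rewrite /t; lra.
have : 0 < t by rewrite /t; lra.
nra.
Qed.

(** The peak is 1 / sqrt(2 pi), and pi >= 3 suffices because [6 * 0.41^2 > 1]. *)
Lemma npdf_le (x : R) : npdf x <= 41 / 100.
Proof.
rewrite npdfE -[leRHS]mulr1 ler_pM ?invr_ge0 ?sqrtr_ge0 ?expR_ge0 //; last first.
  by rewrite -[leRHS]expR0 ler_expR; have := sqr_ge0 x; lra.
rewrite -[leRHS]invrK lef_pV2 ?posrE ?invr_gt0 ?sqrtr_gt0 ?mulr_gt0 ?pi_gt0 //.
rewrite -(@ler_pXn2r _ 2) ?nnegrE ?sqrtr_ge0 // sqr_sqrtr ?mulr_ge0 ?pi_ge0 //.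
by have := pi_ge3; lra.
Qed.

(** The bound is slightly above sqrt 2, so pi < 4 is enough. *)
Lemma mills0_le : mills 0 <= 283 / 200 :> R.
Proof.
rewrite mills0 ler_pdivrMr // -(@ler_pXn2r _ 2) ?nnegrE ?sqrtr_ge0 //.
rewrite sqr_sqrtr ?mulr_ge0 ?pi_ge0 //.
by have := @pihalf_lt2 R; lra.
Qed.

Lemma ncdf_lip (x y : R) : x <= y -> ncdf y - ncdf x <= 41 / 100 * (y - x).
Proof.
move=> xy; have [c _ ->] := is_derive_MVT is_derive_ncdf xy.
by rewrite ler_wpM2r ?subr_ge0 ?npdf_le.
Qed.

End numeric_bounds.

(** * One-sided trapezoidal estimates on half steps *)

Section trapezoid.
Context {R : realType}.
Variables F F1 F2 : R -> R.
Hypothesis dF : forall x : R, is_derive x 1 F (F1 x).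
Hypothesis dF1 : forall x : R, is_derive x 1 F1 (F2 x).

(** This and its mirror image treat the two halves of a lattice step. Splitting at the midpoint [c]
    permits a different function on each side of [c], which the step across [z] requires. *)
Lemma taylor_right_le c b s : c <= b -> (forall x, c <= x <= b -> F2 x <= s) ->
  (b - c) * F1 b - (F b - F c) <= s * (b - c) ^+ 2 / 2.
Proof.
move=> cb F2s.
have d (x : R) : is_derive x 1
    (fun x => s * (x - c) ^+ 2 / 2 - (x - c) * F1 x + F x) ((x - c) * (s - F2 x)).
  have := dF x; have := dF1 x => d1 d0.
  by apply: is_derive_eq; rewrite /GRing.scale /=; field.
have : _ <= _ := is_derive_ge0_le d _ cb.
rewrite subrr expr0n mulr0 !mul0r; move/(_ _)/wrap => [|]; last by lra.
by move=> x /andP[cx xb]; rewrite mulr_ge0 ?subr_ge0 // F2s // cx.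
Qed.

Lemma taylor_left_le a c s : a <= c -> (forall x, a <= x <= c -> s <= F2 x) ->
  (c - a) * F1 a - (F c - F a) <= - (s * (c - a) ^+ 2 / 2).
Proof.
move=> ac F2s.
have d (x : R) : is_derive x 1
    (fun x => s * (c - x) ^+ 2 / 2 + (c - x) * F1 x + F x) ((c - x) * (F2 x - s)).
  have := dF x; have := dF1 x => d1 d0.
  by apply: is_derive_eq; rewrite /GRing.scale /=; field.
have : _ <= _ := is_derive_ge0_le d _ ac.
rewrite subrr expr0n mulr0 !mul0r; move/(_ _)/wrap => [|]; last by lra.
by move=> x /andP[ax xc]; rewrite mulr_ge0 ?subr_ge0 // F2s // ax.
Qed.

End trapezoid.

(** * Stein's method at a point halfway between two atoms *)

Section stein.
Context {R : realType} {I : finType}.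
Variables (p : I -> R) (B M : R) (k : nat).
Hypothesis p01 : forall i, 0 <= p i <= 1.
Hypothesis B0 : 0 < B.
Hypothesis B2 : B ^+ 2 = \sum_i p i * (1 - p i).
Let rem i := pbin p (fun j => predT j && (j != i)).
Hypothesis remM : forall i m, (rem i)`_m <= M.

Definition pmean := \sum_i p i.
Definition atom (m : nat) : R := (m%:R - pmean) / B.
Let z : R := (k%:R + 1 / 2 - pmean) / B.
Let w i := p i * (1 - p i) / B ^+ 2.

(* [sol], [dsol] and [ddsol] are the bounded solution of Stein's equation
   [f' w - w f w = (w <= z) - ncdf z] and its first two derivatives at the atoms,
   except that [ddsol] is frozen at [z+] beyond [z]. *)
Let sol m := if (m <= k)%N then ncdf (- z) * mills (atom m)
             else ncdf z * mills (- atom m).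
Let dsol m := if (m <= k)%N then ncdf (- z) * mills1 (atom m)
              else - (ncdf z * mills1 (- atom m)).
Let ddsol m := if (m <= k)%N then ncdf (- z) * mills2 (atom m)
               else ncdf z * mills2 (- z).

Let BN0 : B != 0. Proof. by rewrite gt_eqF. Qed.

Lemma atomS m : atom m.+1 = atom m + B^-1.
Proof. by rewrite /atom -natr1; field. Qed.

Let zE : z = atom k + B^-1 / 2.
Proof. by rewrite /z /atom; field. Qed.

Lemma atom_le m n : (m <= n)%N -> atom m <= atom n.
Proof. by move=> mn; rewrite ler_pM2r ?invr_gt0 // lerD2r ler_nat. Qed.

Let atom_lez m : (m <= k)%N -> atom m <= z.
Proof. by move=> /atom_le/le_trans; apply; rewrite zE lerDl divr_ge0 ?invr_ge0 ?ltW. Qed.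

Let atom_gez m : (k < m)%N -> z <= atom m.
Proof.
move=> /atom_le; apply: le_trans; rewrite zE atomS lerD2l.
have : 0 < B^-1 by rewrite invr_gt0.
lra.
Qed.

Let dleft (x : R) : is_derive x 1 (fun x => ncdf (- z) * mills x)
  (ncdf (- z) * mills1 x).
Proof.
by have := is_derive_mills x => d; apply: is_derive_eq; rewrite /GRing.scale /=; ring.
Qed.

Let dleft1 (x : R) : is_derive x 1 (fun x => ncdf (- z) * mills1 x)
  (ncdf (- z) * mills2 x).
Proof.
by have := is_derive_mills1 x => d; apply: is_derive_eq; rewrite /GRing.scale /=; ring.
Qed.

Let dright (x : R) : is_derive x 1 (fun x => ncdf z * mills (- x))
  (- (ncdf z * mills1 (- x))).
Proof.
have d : is_derive x (1 : R) (fun x : R => mills (- x)) (mills1 (- x) * -1).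
  have := is_derive_mills (- x) => d; exact: (@is_derive1_comp _ mills -%R).
by apply: is_derive_eq; rewrite /GRing.scale /=; ring.
Qed.

Let dright1 (x : R) : is_derive x 1 (fun x => - (ncdf z * mills1 (- x)))
  (ncdf z * mills2 (- x)).
Proof.
have d : is_derive x (1 : R) (fun x : R => mills1 (- x)) (mills2 (- x) * -1).
  have := is_derive_mills1 (- x) => d; exact: (@is_derive1_comp _ mills1 -%R).
by apply: is_derive_eq; rewrite /GRing.scale /=; ring.
Qed.

Let nz0 (x : R) : 0 <= ncdf x := ncdf_ge0 x.

Let stein_eq m : dsol m - atom m * sol m = (m <= k)%N%:R - ncdf z.
Proof.
rewrite /dsol /sol; case: (m <= k)%N; rewrite /mills1 ?ncdfN /=; ring.
Qed.

(** To the left of [z] the second derivative of the solution increases, so its values at the ends of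
    the step bound it on the two halves. *)
Let trapezoid_dsol m : (dsol m + dsol m.+1) / 2 - B * (sol m.+1 - sol m)
  <= (ddsol m.+1 - ddsol m) / (8 * B).
Proof.
pose h := B^-1 / 2; have h0 : 0 <= h by rewrite divr_ge0 ?invr_ge0 ?ltW.
pose c := atom m + h.
have ac : atom m <= c by rewrite lerDl.
have cb : c <= atom m.+1 by rewrite atomS /c; rewrite /h in h0 *; lra.
have ca : c - atom m = h by rewrite /c; ring.
have bc : atom m.+1 - c = h by rewrite atomS /c /h; field.
suff: h * (dsol m + dsol m.+1) - (sol m.+1 - sol m)
    <= (ddsol m.+1 - ddsol m) * h ^+ 2 / 2.
  move=> le; rewrite -(@ler_pM2l _ B^-1) ?invr_gt0 //.
  have -> : B^-1 * ((dsol m + dsol m.+1) / 2 - B * (sol m.+1 - sol m)) =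
    h * (dsol m + dsol m.+1) - (sol m.+1 - sol m) by rewrite /h; field.
  by apply: le_trans le _; rewrite le_eqVlt; apply/orP; left; apply/eqP; rewrite /h; field.
have [mk|mk|mk] := ltngtP m k.
- rewrite /sol /dsol /ddsol mk (ltnW mk).
  have := @taylor_left_le _ _ _ _ dleft dleft1 (atom m) c
    (ncdf (- z) * mills2 (atom m)) ac.
  have := @taylor_right_le _ _ _ _ dleft dleft1 c (atom m.+1)
    (ncdf (- z) * mills2 (atom m.+1)) cb.
  rewrite ca bc => /(_ _)/wrap[x /andP[_ xb]|t1].
    by rewrite ler_wpM2l // mills2_le.
  move=> /(_ _)/wrap[x /andP[ax _]|t2]; first by rewrite ler_wpM2l // mills2_le.
  lra.
- rewrite /sol /dsol /ddsol ltnNge (ltnW mk) /= leqNgt mk /=.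
  have := @taylor_left_le _ _ _ _ dright dright1 (atom m) c
    (ncdf z * mills2 (- c)) ac.
  have := @taylor_right_le _ _ _ _ dright dright1 c (atom m.+1)
    (ncdf z * mills2 (- c)) cb.
  rewrite ca bc => /(_ _)/wrap[x /andP[cx _]|t1].
    by rewrite ler_wpM2l // mills2_le // lerN2.
  move=> /(_ _)/wrap[x /andP[_ xc]|t2]; first by rewrite ler_wpM2l // mills2_le // lerN2.
  lra.
(* Here the midpoint is [z] itself, where the branches change and their values agree. *)
- rewrite /sol /dsol /ddsol mk leqnn ltnn.
  have cz : c = z by rewrite zE /c /h mk.
  have := @taylor_left_le _ _ _ _ dleft dleft1 (atom m) c
    (ncdf (- z) * mills2 (atom m)) ac.
  have := @taylor_right_le _ _ _ _ dright dright1 c (atom m.+1)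
    (ncdf z * mills2 (- c)) cb.
  rewrite ca bc => /(_ _)/wrap[x /andP[cx _]|t1].
    by rewrite ler_wpM2l // mills2_le // lerN2.
  move=> /(_ _)/wrap[x /andP[ax _]|t2]; first by rewrite ler_wpM2l // mills2_le.
  move: t1 t2; rewrite mk cz (ncdf_mills_sym z); lra.
Qed.

(** The derivative of the solution drops by 1 at [z]. Adding the jump back gives a nondecreasing
    function with values between 0 and 1. *)
Let G m := dsol m + (k < m)%N%:R.

Let GE m : G m = if (m <= k)%N then ncdf (- z) * mills1 (atom m)
                 else 1 - ncdf z * mills1 (- atom m).
Proof. by rewrite /G /dsol ltnNge; case: (m <= k)%N => /=; ring. Qed.

(* The two branches of [G] agree at [z]. *)
Let G_glue : ncdf (- z) * mills1 z = 1 - ncdf z * mills1 (- z).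
Proof.
have := ncdf_mills_sym z; rewrite /mills1 ncdfN => e.
transitivity (1 - ncdf z + z * ((1 - ncdf z) * mills z)); first by ring.
by rewrite e; ring.
Qed.

Let left_ge0 x : 0 <= ncdf (- z) * mills1 x.
Proof. by rewrite mulr_ge0 // ltW // mills1_gt0. Qed.

Let right_ge0 x : 0 <= ncdf z * mills1 x.
Proof. by rewrite mulr_ge0 // ltW // mills1_gt0. Qed.

Let G_lez m : (m <= k)%N -> G m <= ncdf (- z) * mills1 z.
Proof. by move=> mk; rewrite GE mk ler_wpM2l // mills1_le // atom_lez. Qed.

Let G_gez m : (k < m)%N -> 1 - ncdf z * mills1 (- z) <= G m.
Proof.
move=> km; rewrite GE leqNgt km /= lerD2l lerN2 ler_wpM2l // mills1_le // lerN2.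
exact: atom_gez.
Qed.

Let G0 m : 0 <= G m.
Proof.
have [mk|km] := leqP m k; first by rewrite GE mk.
by rewrite (le_trans _ (G_gez km)) // -G_glue.
Qed.

Let G1 m : G m <= 1.
Proof.
have [mk|km] := leqP m k.
  by rewrite (le_trans (G_lez mk)) // G_glue gerBl.
by rewrite GE leqNgt km /= gerBl.
Qed.

Let G_le m : G m <= G m.+1.
Proof.
have [mk|mk|mk] := ltngtP m k.
- by rewrite !GE mk (ltnW mk) ler_wpM2l // mills1_le // atom_le.
- rewrite !GE ltnNge (ltnW mk) /= leqNgt mk /= lerD2l lerN2 ler_wpM2l //.
  by rewrite mills1_le // lerN2 atom_le.
- by rewrite (le_trans (G_lez _)) ?mk // G_glue G_gez // mk.
Qed.

Let rem_ge0 i m : 0 <= (rem i)`_m. Proof. exact: pbin_coef_ge0. Qed.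

Let M0 (i : I) : 0 <= M. Proof. exact: le_trans (rem_ge0 i 0) (remM i 0). Qed.

(** The increments of [G] are nonnegative and telescope to at most 1, so weights bounded by [M] give
    at most [M]. *)
Let sum_diff_le (g : {poly R}) : (forall m, 0 <= g`_m <= M) -> 0 <= M ->
  0 <= pexp g (fun m => G m.+1 - G m) <= M.
Proof.
move=> gM Mge0; apply/andP; split.
  by apply: sumr_ge0 => m _; have /andP[? _] := gM m; rewrite mulr_ge0 ?subr_ge0.
apply: (@le_trans _ _ (\sum_(m < size g) M * (G m.+1 - G m))).
  by apply: ler_sum => m _; have /andP[_ ?] := gM m; rewrite ler_wpM2r ?subr_ge0.
rewrite -mulr_sumr -(big_mkord xpredT (fun m => G m.+1 - G m)) telescope_sumr //.
rewrite -[leRHS]mulr1 ler_wpM2l //.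
by have := G0 0; have := G1 (size g); lra.
Qed.

Let pexp_delta (g : {poly R}) : pexp g (fun m => (m == k)%:R) = g`_k.
Proof.
have [kg|gk] := ltnP k (size g); last first.
  rewrite nth_default // /pexp big1 // => m _.
  by rewrite ltn_eqF ?mulr0 // (leq_trans _ gk).
rewrite /pexp (bigD1 (Ordinal kg)) //= eqxx mulr1 big1 ?addr0 // => m mk.
by rewrite (_ : (_ == k) = false) ?mulr0 //; apply: contraNF mk => /eqP mk; apply/eqP/val_inj.
Qed.

(** The expectation is that of the increments of [G] minus the mass at [k]. Both lie in [0, M], so
    their difference is at most [M] in absolute value, not [2 M]. *)
Let dsol_diff i : `|pexp (rem i) (fun m => dsol m.+1 - dsol m)| <= M.
Proof.
rewrite (_ : pexp _ _ = pexp (rem i) (fun m => G m.+1 - G m) - (rem i)`_k); last first.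
  rewrite -pexp_delta -pexp_funB; apply: eq_pexp => m; rewrite /G ltnS.
  by case: ltngtP => _ /=; ring.
have /andP[s0 sM] := @sum_diff_le (rem i) (fun m => introT andP (conj (rem_ge0 i m) (remM i m))) (M0 i).
rewrite ler_norml; have := rem_ge0 i k; have := remM i k; lra.
Qed.

Let sumw : \sum_i w i = 1.
Proof. by rewrite -mulr_suml -B2 divff // expf_neq0. Qed.

Let g := pbin p predT.

Let pexp_rem i h : pexp g h
  = (1 - p i) * pexp (rem i) h + p i * pexp (rem i) (fun m => h m.+1).
Proof. by rewrite /g (@pbin_rem _ _ p predT i) // pexp_bernM. Qed.

Let stein_atom h : pexp g (fun m => atom m * h m)
  = B * \sum_i w i * (pexp (rem i) (fun m => h m.+1) - pexp (rem i) h).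
Proof.
rewrite (@eq_pexp _ _ _ (fun m => B^-1 * ((m%:R - pmean) * h m))); last first.
  by move=> m; rewrite /atom; ring.
rewrite pexp_funZ pbin_stein mulr_sumr mulr_sumr; apply: eq_bigr => i _.
by rewrite /w; field.
Qed.

Let atom_mean : pexp g atom = 0.
Proof.
rewrite (@eq_pexp _ _ _ (fun m => B^-1 * (m%:R - pmean))) => [|m]; last by rewrite mulrC.
by rewrite pexp_funZ pbin_mean mulr0.
Qed.

Let atom_var : pexp g (fun m => atom m ^+ 2) = 1.
Proof.
rewrite (@eq_pexp _ _ _ (fun m => B^-2 * (m%:R - pmean) ^+ 2)) => [|m]; last first.
  by rewrite /atom; field.
by rewrite pexp_funZ pbin_var -B2 mulVf // expf_neq0.
Qed.

Definition mom_bound : R := mills 0 / 2 + 1.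

Let ddsol_ge0 m : 0 <= ddsol m.
Proof. by rewrite /ddsol; case: ifP => _; rewrite mulr_ge0 // ltW // mills2_gt0. Qed.

(** The quadratic with [e = 1] or [e = -1] is the majorant used for [atom_ddsol_le]; the atoms have
    mean 0 and variance 1. *)
Let pexp_quad e : e ^+ 2 = 1 ->
  pexp g (fun m => mills 0 * (1 + e * atom m) ^+ 2 / 4 + atom m ^+ 2) = mom_bound.
Proof.
move=> e2; rewrite (@eq_pexp _ _ _ (fun m => mills 0 / 4 + ((mills 0 * e / 2) * atom m
   + (mills 0 / 4 + 1) * atom m ^+ 2))) => [|m]; last first.
  have -> : (1 + e * atom m) ^+ 2 = 1 + 2 * e * atom m + e ^+ 2 * atom m ^+ 2 by ring.
  by rewrite e2; field.
by rewrite !pexp_funD !pexp_funZ atom_mean atom_var pexp_pbin_cst // /mom_bound; field.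
Qed.

(** If [z >= 0], negative atoms contribute at most 0, while at positive ones
    [ddsol m <= mills 0 + atom m]. The product is then bounded through [a <= (1 + a)^2 / 4]. If
    [z < 0], the signs are reversed. *)
Let atom_ddsol_le : pexp g (fun m => atom m * ddsol m) <= mom_bound.
Proof.
have m00 : 0 < mills 0 :> R by exact: mills_gt0.
have Gle1 x : x <= z -> ncdf (- z) * mills1 x <= 1.
  move=> xz; rewrite (@le_trans _ _ (ncdf (- z) * mills1 z)) //.
    by rewrite ler_wpM2l // mills1_le.
  by rewrite G_glue gerBl.
have Gle1' : ncdf z * mills1 (- z) <= 1 by have := G_glue; have := left_ge0 z; lra.
have [z0|z0] := leP 0 z.
  have s0 : ncdf z * mills (- z) <= mills 0.
    rewrite -[leRHS]mul1r ler_pM // ?ncdf_le1 ?mills_le ?oppr_le0 //.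
    by rewrite ltW // mills_gt0.
  rewrite -(@pexp_quad 1) ?expr1n //; apply: pexp_pbin_le => // m; rewrite mul1r.
  have [a0|a0] := leP (atom m) 0.
    apply: (@le_trans _ _ 0); first by rewrite mulr_le0_ge0 ?ddsol_ge0.
    rewrite addr_ge0 ?sqr_ge0 //.
    by rewrite divr_ge0 // mulr_ge0 ?sqr_ge0 // ltW.
  have : ddsol m <= mills 0 + atom m.
    rewrite /ddsol /mills2; case: ifPn => mk; rewrite mulrDr lerD //.
    - apply: le_trans s0; rewrite -ncdf_mills_sym ler_wpM2l // mills_le //.
      exact: atom_lez.
    - by rewrite mulrCA -[leRHS]mulr1 ler_wpM2l ?(ltW a0) // Gle1 // atom_lez.
    - rewrite mulrCA (@le_trans _ _ 0) ?(ltW a0) //.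
      by rewrite mulr_le0_ge0 // oppr_le0.
  move=> /(ler_wpM2l (ltW a0)) le; apply: le_trans le _.
  have : 0 <= mills 0 * (1 - atom m) ^+ 2 by rewrite mulr_ge0 ?sqr_ge0 // ltW.
  lra.
pose s := ncdf z * mills2 (- z).
have s0 : 0 <= s by rewrite mulr_ge0 // ltW // mills2_gt0.
have sle : s <= mills 0 - z.
  rewrite /s /mills2 mulrDr lerD //.
    rewrite -ncdf_mills_sym -[leRHS]mul1r ler_pM // ?ncdf_le1 ?mills_le ?(ltW z0) //.
    by rewrite ltW // mills_gt0.
  by rewrite mulrCA -[leRHS]mulr1 ler_wpM2l // oppr_ge0 (ltW z0).
rewrite (_ : pexp _ _ = pexp g (fun m => atom m * (ddsol m - s))); last first.
  rewrite (@eq_pexp _ _ (fun m => atom m * (ddsol m - s))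
    (fun m => atom m * ddsol m - s * atom m)) => [|m]; last by ring.
  by rewrite pexp_funB pexp_funZ atom_mean mulr0 subr0.
rewrite -(@pexp_quad (-1)) ?sqrrN ?expr1n //; apply: pexp_pbin_le => // m.
rewrite mulN1r; have [mk|km] := leqP m k; last first.
  rewrite /ddsol leqNgt km /= -/s subrr mulr0 addr_ge0 ?sqr_ge0 //.
  by rewrite divr_ge0 // mulr_ge0 ?sqr_ge0 // ltW.
have az := atom_lez mk.
have h1 : atom m * ddsol m <= 0 by rewrite mulr_le0_ge0 ?ddsol_ge0 // (le_trans az) // (ltW z0).
have h2 : - atom m * s <= - atom m * (mills 0 - atom m).
  rewrite ler_wpM2l ?oppr_ge0 ?(le_trans az) ?(ltW z0) //; lra.
have : 0 <= mills 0 * (1 + atom m) ^+ 2 by rewrite mulr_ge0 ?sqr_ge0 // ltW.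
nra.
Qed.

(* Stein's equation, the trapezoidal rule on each step of the lattice and the
   centering of [z] between two atoms. *)
Lemma pbin_cdf_upper :
  pexp g (fun m => (m <= k)%N%:R) - ncdf z
  <= (\sum_i w i * `|1 - 2 * p i|) / 2 * M + mom_bound / (8 * B ^+ 2).
Proof.
pose T m := (dsol m + dsol m.+1) / 2 - B * (sol m.+1 - sol m).
(* Conditioning on variable i weights the two ends of a step by [1 - p i] and [p i]. The deviation
   of these weights from 1 / 2 is split off, leaving the trapezoidal error [T]. *)
have -> : pexp g (fun m => (m <= k)%N%:R) - ncdf z
  = \sum_i w i * ((p i - 1 / 2) * pexp (rem i) (fun m => dsol m.+1 - dsol m)
                   + pexp (rem i) T).
  rewrite -[X in _ - X](pexp_pbin_cst p predT) -pexp_funB.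
  under eq_pexp do rewrite -stein_eq.
  rewrite pexp_funB stein_atom.
  rewrite (_ : pexp g dsol = \sum_i w i * pexp g dsol); last first.
    by rewrite -mulr_suml sumw mul1r.
  rewrite mulr_sumr -sumrB.
  apply: eq_bigr => i _; rewrite (pexp_rem i).
  rewrite /T pexp_funB pexp_funB pexp_funZ pexp_funB.
  rewrite (@eq_pexp _ _ (fun m => (dsol m + dsol m.+1) / 2)
     (fun m => 2^-1 * (dsol m + dsol m.+1))) => [|m]; last by rewrite mulrC.
  rewrite pexp_funZ pexp_funD. by field.
under eq_bigr do rewrite mulrDr.
have w0 i : 0 <= w i.
  by have /andP[? ?] := p01 i; rewrite divr_ge0 ?sqr_ge0 // mulr_ge0 // subr_ge0.
rewrite big_split /=; apply: lerD.
  rewrite !mulr_suml; apply: ler_sum => i _.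
  rewrite -!(mulrA (w i)) ler_wpM2l //.
  have le := dsol_diff i; set D := pexp _ _ in le *.
  rewrite (le_trans (ler_norm _)) // normrM ler_pM //.
  rewrite (_ : p i - 1 / 2 = - ((1 - 2 * p i) / 2)); last by field.
  by rewrite normrN normrM [`|_^-1|]ger0_norm.
apply: (@le_trans _ _ (\sum_i w i * ((8 * B)^-1 *
    (pexp (rem i) (fun m => ddsol m.+1) - pexp (rem i) ddsol)))).
  apply: ler_sum => i _; rewrite ler_wpM2l // -pexp_funB -pexp_funZ.
  by apply: pexp_pbin_le => // m; rewrite mulrC; exact: trapezoid_dsol.
(* Stein's identity read backwards collapses the summed increments. *)
rewrite (_ : \sum_i _ = pexp g (fun m => atom m * ddsol m) / (8 * B ^+ 2)).
  by rewrite ler_pM2r // invr_gt0 mulr_gt0 ?exprn_gt0.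
rewrite stein_atom mulrAC mulr_sumr; apply: eq_bigr => i _; by field.
Qed.

End stein.

(** * Exchanging successes and failures *)

Section reflection.
Context {R : realType} {I : finType}.
Implicit Types p : I -> R.

Lemma eq_pexp_in (g : {poly R}) (h1 h2 : nat -> R) :
  (forall m, (m < size g)%N -> h1 m = h2 m) -> pexp g h1 = pexp g h2.
Proof. by move=> e; apply: eq_bigr => i _; rewrite e. Qed.

Lemma size_prod_bern p (r : seq I) :
  (size (\prod_(i <- r) bern (p i))%R <= (size r).+1)%N.
Proof.
elim: r => [|i r IH]; first by rewrite big_nil size_poly1.
rewrite big_cons (leq_trans (size_polyMleq _ _)) //=.
have : (size (bern (p i)) <= 2)%N.
  rewrite (leq_trans (size_polyD _ _)) // geq_max.
  rewrite (leq_trans (size_polyC_leq1 _)) //.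
  by rewrite (leq_trans (size_scale_leq _ _)) // size_polyX.
by move=> /leq_add/(_ IH); rewrite -subn1 leq_subLR add1n add2n.
Qed.

Lemma pexp_reflect p (r : seq I) (h : nat -> R) :
  pexp (\prod_(i <- r) bern (1 - p i)) h
  = pexp (\prod_(i <- r) bern (p i)) (fun m => h (size r - m)%N).
Proof.
elim: r h => [|i r IH] h.
  by rewrite !big_nil; apply: eq_pexp_in => m; rewrite size_poly1; case: m.
rewrite !big_cons !pexp_bernM !IH opprB addrCA subrr addr0 addrC.
(* The degree bound gives [m <= size r], so the truncated subtraction is exact. *)
congr (_ * _ + _ * _); apply: eq_pexp_in => m ms.
by rewrite /= subSn // -ltnS (leq_trans ms) ?size_prod_bern.
Qed.

Let size_index_enum : size (index_enum I) = #|I|.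
Proof. by rewrite [index_enum _]unlock -enumT -cardT. Qed.

Lemma pbin_reflect p (h : nat -> R) :
  pexp (pbin (fun i => 1 - p i) predT) h = pexp (pbin p predT) (fun m => h (#|I| - m)%N).
Proof. by rewrite /pbin pexp_reflect size_index_enum. Qed.

Lemma size_pbin p : (size (pbin p predT) <= #|I|.+1)%N.
Proof. by rewrite (leq_trans (size_prod_bern _ _)) // size_index_enum. Qed.

End reflection.

(** * The upper bound at half-lattice points *)

Section berry_esseen.
Context {R : realType} {I : finType}.
Variables (p : I -> R) (B : R).
Hypothesis p01 : forall i, 0 <= p i <= 1.
Hypothesis B1 : 1 <= B.
Hypothesis B2 : B ^+ 2 = \sum_i p i * (1 - p i).

Let B0 : 0 < B. Proof. exact: lt_le_trans B1. Qed.

Definition local_err : R := 1 / (2 * B) + 5 / (16 * B ^+ 3).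
Definition skew : R := \sum_i p i * (1 - p i) / B ^+ 2 * `|1 - 2 * p i|.
Definition stein_err : R := skew / 2 * local_err + mom_bound / (8 * B ^+ 2).

(** The 3 / 4 is [1 - 1 / 4]: here [s ^+ 2] is 1 plus the variance without one variable, whose own
    variance is at most 1 / 4. After squaring and setting [s^2 = t + 3 / 4 + d], the difference is a
    polynomial in [t] and [d] with nonnegative coefficients. *)
Lemma local_err_le (s : R) : 0 < s -> B ^+ 2 + 3 / 4 <= s ^+ 2 ->
  (s ^+ 2 + 1) / (2 * s ^+ 3) <= local_err.
Proof.
move=> s0 Bs.
have -> : local_err = (8 * B ^+ 2 + 5) / (16 * B ^+ 3).
  by rewrite /local_err; field; rewrite gt_eqF.
rewrite ler_pdivrMr ?mulr_gt0 ?exprn_gt0 // mulrAC ler_pdivlMr ?mulr_gt0 ?exprn_gt0 //.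
rewrite -(@ler_pXn2r _ 2) ?nnegrE ?mulr_ge0 ?addr_ge0 ?mulr_ge0 ?exprn_ge0 ?(ltW s0) ?(ltW B0) //.
pose t := B ^+ 2; pose d := s ^+ 2 - (t + 3 / 4).
have d0 : 0 <= d by rewrite subr_ge0.
have t0 : 0 <= t by rewrite sqr_ge0.
have us : s ^+ 2 = t + 3 / 4 + d by rewrite /d; ring.
have -> : ((s ^+ 2 + 1) * (16 * B ^+ 3)) ^+ 2 = 4 * (64 * t ^+ 3 * (s ^+ 2 + 1) ^+ 2).
  by rewrite /t; ring.
have -> : ((8 * B ^+ 2 + 5) * (2 * s ^+ 3)) ^+ 2 = 4 * ((8 * t + 5) ^+ 2 * (s ^+ 2) ^+ 3).
  by rewrite /t; ring.
rewrite ler_pM2l // us -subr_ge0.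
have -> : (8 * t + 5) ^+ 2 * (t + 3 / 4 + d) ^+ 3 - 64 * t ^+ 3 * (t + 3 / 4 + d + 1) ^+ 2
  = (117 * t ^+ 3 + 873 / 4 * t ^+ 2 + 1215 / 16 * t + 675 / 64)
    + (64 * t ^+ 4 + 304 * t ^+ 3 + 543 * t ^+ 2 + 495 / 2 * t + 675 / 16) * d
    + (128 * t ^+ 3 + 384 * t ^+ 2 + 255 * t + 225 / 4) * d ^+ 2
    + (64 * t ^+ 2 + 80 * t + 25) * d ^+ 3 by field.
by do ![exact: d0 | exact: t0 | exact: ler0n | apply: exprn_ge0 | apply: addr_ge0
  | apply: mulr_ge0 | rewrite invr_ge0].
Qed.

Lemma rem_coef_le i m :
  (pbin p (fun j => predT j && (j != i)))`_m <= local_err.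
Proof.
pose v := \sum_(j | predT j && (j != i)) p j * (1 - p j).
have v0 : 0 <= v.
  by apply: sumr_ge0 => j _; have /andP[? ?] := p01 j; rewrite mulr_ge0 // subr_ge0.
have Bv : B ^+ 2 = p i * (1 - p i) + v by rewrite B2 (bigD1 i).
have s0 : 0 < Num.sqrt (1 + v) by rewrite sqrtr_gt0; lra.
apply: le_trans (@pbin_coef_le R I p p01 _ m (Num.sqrt (1 + v)) _ _) _.
- by rewrite -[leLHS]sqrtr1 ler_wsqrtr // lerDl.
- by rewrite sqr_sqrtr // addr_ge0.
- apply: local_err_le => //; rewrite sqr_sqrtr ?addr_ge0 // Bv.
  by have := sqr_ge0 (p i - 1 / 2); nra.
Qed.

Lemma cdf_upper k : pexp (pbin p predT) (fun m => (m <= k)%N%:R)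
  - ncdf ((k%:R + 1 / 2 - \sum_i p i) / B) <= stein_err.
Proof. exact: (@pbin_cdf_upper _ _ p B local_err k p01 B0 B2 rem_coef_le). Qed.

End berry_esseen.

Lemma kolmogorov_numeric (R : realFieldType) (B t m : R) : 1 <= B -> m <= 283 / 200 ->
  B ^+ 2 * (t / 4 + 41 / 200) + 5 / 32 * t + B * (m / 2 + 1) / 8
  <= 5591 / 10000 * (B ^+ 2 * (1 + t ^+ 2) / 2 + 3).
Proof.
move=> B1 m1.
have h0 : 0 <= B * (283 / 200 - m) by rewrite mulr_ge0 ?subr_ge0 //; lra.
(* In right side minus left side, 2500 / 5591 minimizes the coefficient of [B ^+ 2] over [t], and
   8125 / 11182 minimizes the value at [B = 1]. The remaining quadratic in [B] has its vertex near
   23 / 4. *)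
have h1 : 0 <= (B ^+ 2 - 1) * (t - 2500 / 5591) ^+ 2.
  by rewrite mulr_ge0 ?sqr_ge0 // subr_ge0 exprn_ege1.
have h2 := sqr_ge0 (t - 8125 / 11182); have h3 := sqr_ge0 (B - 23 / 4).
lra.
Qed.

(** * From half-lattice points to all points, and comparison with the third moments *)

Section kolmogorov.
Context {R : realType} {I : finType}.
Variables (p : I -> R) (B : R).
Hypothesis p01 : forall i, 0 <= p i <= 1.
Hypothesis B1 : 1 <= B.
Hypothesis B2 : B ^+ 2 = \sum_i p i * (1 - p i).

Let B0 : 0 < B. Proof. exact: lt_le_trans B1. Qed.
Let BN0 : B != 0. Proof. by rewrite gt_eqF. Qed.

Lemma skew_reflect : skew (fun i => 1 - p i) B = skew p B.
Proof.
apply: eq_bigr => i _ /=; rewrite -[`|1 - 2 * p i|]normrN.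
have -> : 1 - 2 * (1 - p i) = - (1 - 2 * p i) by ring.
by rewrite subKr [(1 - p i) * _]mulrC.
Qed.

(** The event [m <= k] is the complement of [#|I| - m <= #|I| - k.+1], and reflection negates the
    standardized midpoint, so the upper bound applies. *)
Lemma cdf_lower k : (k < #|I|)%N -> - stein_err p B <=
  pexp (pbin p predT) (fun m => (m <= k)%N%:R)
  - ncdf ((k%:R + 1 / 2 - \sum_i p i) / B).
Proof.
move=> kn.
have q01 i : 0 <= 1 - p i <= 1.
  by have /andP[? ?] := p01 i; rewrite subr_ge0 gerBl; apply/andP.
have Bq : B ^+ 2 = \sum_i (1 - p i) * (1 - (1 - p i)).
  by rewrite B2; apply: eq_bigr => i _; ring.
have := cdf_upper q01 B1 Bq (#|I| - k.+1).
rewrite /stein_err skew_reflect -/(stein_err p B) pbin_reflect.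
rewrite (@eq_pexp_in _ _ _ (fun m => 1 - (m <= k)%N%:R)) => [|m ms]; last first.
  have mI : (m <= #|I|)%N by rewrite -ltnS (leq_trans ms) ?size_pbin.
  rewrite leq_sub2lE // ltnNge; case: (m <= k)%N => /=; ring.
rewrite pexp_funB pexp_pbin_cst //.
have -> : ((#|I| - k.+1)%N%:R + 1 / 2 - \sum_i (1 - p i)) / B
    = - ((k%:R + 1 / 2 - \sum_i p i) / B).
  by rewrite sumrB sumr_const -mulNr natrB // -natr1; field.
by rewrite ncdfN; lra.
Qed.

Lemma stein_err_ge0 : 0 <= stein_err p B.
Proof.
have w0 : 0 <= skew p B.
  apply: sumr_ge0 => i _; have /andP[? ?] := p01 i.
  by rewrite mulr_ge0 // divr_ge0 ?sqr_ge0 // mulr_ge0 // subr_ge0.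
have m0 := mills_gt0 (0 : R).
have b0 := ltW B0; rewrite /stein_err /local_err /mom_bound.
by do ![exact: w0 | exact: ltW | exact: b0 | exact: ler0n | apply: exprn_ge0 | apply: addr_ge0
  | apply: mulr_ge0 | rewrite invr_ge0].
Qed.

(** A midpoint lies [1 / (2 B)] from each neighbouring atom, and [ncdf] has slope at most 0.41.
    Monotonicity means that only these half steps are paid for. *)
Lemma kolmogorov_le x : (0 < #|I|)%N -> (pbin p predT)`_0 = 0 ->
  `|pexp (pbin p predT) (fun m => (atom p B m <= x)%R%:R) - ncdf x|
  <= stein_err p B + 41 / (200 * B).
Proof.
move=> I0 g0; pose g := pbin p predT; pose mu := \sum_i p i.
pose z k : R := (k%:R + 1 / 2 - mu) / B.
have zl k : z k - atom p B k = 1 / (2 * B) by rewrite /z /atom /pmean -/mu; field.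
have zr k : atom p B k.+1 - z k = 1 / (2 * B).
  by rewrite /z /atom /pmean -/mu -natr1; field.
have half : 41 / (200 * B) = 41 / 100 * (1 / (2 * B)) by field.
have h0 : 0 < 1 / (2 * B) by rewrite divr_gt0 ?mulr_gt0.
have err0 := stein_err_ge0.
have ncdf_mono (s t : R) : s <= t -> ncdf s <= ncdf t.
  by apply: is_derive_ge0_le is_derive_ncdf _ => y _; exact/ltW/npdf_gt0.
have up k : atom p B k <= x -> pexp g (fun m => (m <= k)%N%:R) - ncdf x
    <= stein_err p B + 41 / (200 * B).
  move=> /ncdf_mono kx; have := cdf_upper p01 B1 B2 k; rewrite -/g -/mu -/(z k).
  have : atom p B k <= z k by rewrite -subr_ge0 zl ltW.
  move=> /ncdf_lip; rewrite zl half; lra.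
have lo k : (k < #|I|)%N -> x <= atom p B k.+1 ->
    - (stein_err p B + 41 / (200 * B)) <= pexp g (fun m => (m <= k)%N%:R) - ncdf x.
  move=> kn /ncdf_mono kx; have := cdf_lower kn; rewrite -/g -/mu -/(z k).
  have : z k <= atom p B k.+1 by rewrite -subr_ge0 zr ltW.
  move=> /ncdf_lip; rewrite zr half; lra.
have atomE m : (atom p B m <= x) = (m%:R <= B * x + mu).
  by rewrite /atom /pmean -/mu ler_pdivrMr // lerBlDr mulrC.
have [y0|y0] := leP 0 (B * x + mu).
  pose k := Num.truncn (B * x + mu).
  have kE m : (atom p B m <= x) = (m <= k)%N by rewrite atomE truncn_ge_nat.
  rewrite (@eq_pexp _ _ _ (fun m => (m <= k)%N%:R)) => [|m]; last by rewrite kE.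
  rewrite ler_norml up ?kE ?leqnn // andbT.
  have [kn|nk] := ltnP k #|I|.
    by rewrite lo // ltW // ltNge kE ltnn.
  (* Past the last atom the distribution function is 1, and the lower bound is immediate. *)
  rewrite (@eq_pexp_in _ _ _ (fun=> 1)) => [|m ms]; last first.
    by rewrite (leq_trans _ nk) // -ltnS (leq_trans ms) ?size_pbin.
  rewrite pexp_pbin_cst //; have := ncdf_le1 x.
  have : 0 < 41 / (200 * B) by rewrite half mulr_gt0.
  lra.
(* For [x] below every atom, level 0 serves: without mass at 0, the distribution function vanishes
   there too. *)
have P0 : pexp g (fun m => (m <= 0)%N%:R) = 0.
  by apply: big1 => -[[|m] ?] _ /=; rewrite ?mulr0 // -/g g0 mul0r.
have := lo 0%N I0; rewrite P0 sub0r => lo0.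
rewrite (@eq_pexp _ _ _ (fun=> 0)) => [|m]; last first.
  by rewrite atomE leNgt (lt_le_trans y0) // ler0n.
rewrite pexp_pbin_cst // sub0r normrN ger0_norm ?ncdf_ge0 // -lerN2 lo0 //.
rewrite /atom /pmean -/mu ler_pdivlMr //; lra.
Qed.

(** The summand on the right is the third absolute central moment of a Bernoulli variable, and
    [1 - 2 p (1 - p) = (1 + (1 - 2 p)^2) / 2]. What remains is that a weighted variance is
    nonnegative. *)
Lemma jensen_skew :
  B ^+ 2 * (1 + skew p B ^+ 2) / 2 <= \sum_i p i * (1 - p i) * (1 - 2 * (p i * (1 - p i))).
Proof.
pose w i := p i * (1 - p i) / B ^+ 2; pose u i := `|1 - 2 * p i|.
have sw : \sum_i w i = 1 by rewrite -mulr_suml -B2 divff // expf_neq0.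
have w0 i : 0 <= w i.
  by have /andP[? ?] := p01 i; rewrite divr_ge0 ?sqr_ge0 // mulr_ge0 // subr_ge0.
have -> : \sum_i p i * (1 - p i) * (1 - 2 * (p i * (1 - p i)))
    = B ^+ 2 * (1 + \sum_i w i * u i ^+ 2) / 2.
  transitivity (B ^+ 2 / 2 * (\sum_i w i + \sum_i w i * u i ^+ 2)); last by rewrite sw; field.
  rewrite -big_split mulr_sumr; apply: eq_bigr => i _ /=.
  rewrite /u real_normK ?num_real // /w; by field.
rewrite ler_pM2r ?invr_gt0 // ler_pM2l ?exprn_gt0 // lerD2l -subr_ge0.
have -> : \sum_i w i * u i ^+ 2 - skew p B ^+ 2 = \sum_i w i * (u i - skew p B) ^+ 2.
  have e i : w i * (u i - skew p B) ^+ 2 =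
      w i * u i ^+ 2 + (skew p B ^+ 2 * w i - 2 * skew p B * (w i * u i)) by ring.
  under [RHS]eq_bigr do rewrite e.
  by rewrite big_split sumrB /= -!mulr_sumr sw /skew -/w; ring.
by apply: sumr_ge0 => i _; rewrite mulr_ge0 ?sqr_ge0.
Qed.

Lemma kolmogorov_bound_le :
  stein_err p B + 41 / (200 * B) <= 5591 / 10000 *
   (\sum_i p i * (1 - p i) * (1 - 2 * (p i * (1 - p i))) + 3) / B ^+ 3.
Proof.
pose tau := skew p B.
have B30 : 0 < B ^+ 3 by rewrite exprn_gt0.
apply: (@le_trans _ _ (5591 / 10000 * (B ^+ 2 * (1 + tau ^+ 2) / 2 + 3) / B ^+ 3)); last first.
  rewrite ler_pM2r ?invr_gt0 //; apply: ler_wpM2l; first lra.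
  by rewrite lerD2r jensen_skew.
rewrite ler_pdivlMr //.
have := @mills0_le R => m0.
have -> : (stein_err p B + 41 / (200 * B)) * B ^+ 3 = B ^+ 2 * (tau / 4 + 41 / 200)
     + 5 / 32 * tau + B * mom_bound / 8.
  by rewrite /stein_err /local_err -/tau; field.
exact: kolmogorov_numeric.
Qed.

End kolmogorov.

(** * Comparing sums with integrals for functions of bounded variation *)

Section sum_integral.
Context {R : realType}.
Variables (F f C D : R -> R).
Hypothesis dF : forall x : R, 0 <= x -> is_derive x 1 F (f x).
Hypothesis fCD : forall x y, f y - f x = (C y - C x) - (D y - D x).
Hypothesis C_le : forall x y, 0 <= x -> x <= y -> C x <= C y.
Hypothesis D_le : forall x y, 0 <= x -> x <= y -> D x <= D y.

Let step i : exists2 c : R, i%:R <= c <= i.+1%:R & F i.+1%:R - F i%:R = f c.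
Proof.
have i0 : 0 <= i%:R :> R by [].
have ii : i%:R <= i.+1%:R :> R by rewrite ler_nat.
have [|x|c] := @MVT_segment _ F f i%:R i.+1%:R ii.
- by move=> x; rewrite in_itv /= => /andP[ix _]; apply/dF/(le_trans i0)/ltW.
- apply: derivable_within_continuous => y; rewrite in_itv /= => /andP[iy _].
  by have [] := dF (le_trans i0 iy).
rewrite in_itv /= => cI ->; exists c => //.
by rewrite -natr1 addrC addKr mulr1.
Qed.

(** On each unit interval the increment of [F] is [f c] for some [c], and [f c] exceeds [f] at the
    left end by at most the growth of [C]. *)
Lemma sum_ge_integral n :
  F n%:R - F 0 - (C n%:R - C 0) <= \sum_(i < n) f i%:R.
Proof.
elim: n => [|n IH]; first by rewrite big_ord0 !subrr.
rewrite big_ord_recr /=; have [c /andP[nc cn] Fc] := step n.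
have n0 : 0 <= n%:R :> R by [].
have := fCD n%:R c; have := C_le (le_trans n0 nc) cn; have := D_le n0 nc.
lra.
Qed.

Lemma sum_le_integral n :
  \sum_(i < n) f i%:R <= F n%:R - F 0 + (D n%:R - D 0).
Proof.
elim: n => [|n IH]; first by rewrite big_ord0 !subrr addr0.
rewrite big_ord_recr /=; have [c /andP[nc cn] Fc] := step n.
have n0 : 0 <= n%:R :> R by [].
have := fCD n%:R c; have := D_le (le_trans n0 nc) cn; have := C_le n0 nc.
lra.
Qed.

End sum_integral.

(** * Variance and third moments for the probabilities theta / (theta + i) *)

Section ewens_sums.
Context {R : realType}.
Variables (theta : R) (n : nat).
Hypothesis t0 : 0 < theta.

Definition eprob (x : R) : R := theta / (theta + x).

Lemma eprob_gt0 x : 0 <= x -> 0 < eprob x.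
Proof. by move=> x0; rewrite divr_gt0 // ltr_pwDl. Qed.

Lemma eprob_le1 x : 0 <= x -> eprob x <= 1.
Proof. by move=> x0; rewrite ler_pdivrMr ?ltr_pwDl // mul1r lerDl. Qed.

Lemma eprob_le x y : 0 <= x -> x <= y -> eprob y <= eprob x.
Proof.
move=> x0 xy; rewrite ler_pM2l // lef_pV2 ?posrE ?lerD2l // ltr_pwDl //.
exact: le_trans xy.
Qed.

Let y x := eprob x * (1 - eprob x).

(** These are the antiderivatives, vanishing at 0, of [y] and [y (1 - 2 y)]; they appear inside
    [var_bound] and [gamma1]. *)
Definition evar_int (x : R) := theta * (ln (1 + x / theta) - 1 + theta / (x + theta)).
Definition eskew_int (x : R) :=
  theta * (ln (1 + x / theta) - 5 / 3 + 3 * theta / (x + theta)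
            - 2 * theta ^+ 2 / (x + theta) ^+ 2
            + 2 * theta ^+ 3 / (3 * (x + theta) ^+ 3)).

Let tN0 : theta != 0. Proof. by rewrite gt_eqF. Qed.

Let dln (x : R) : 0 <= x -> is_derive x 1 (fun x => ln (1 + x / theta)) (theta + x)^-1.
Proof.
move=> x0; have p0 : 0 < 1 + x / theta by rewrite ltr_pwDl // divr_ge0 // ltW.
have d1 : is_derive x (1 : R) (fun x : R => 1 + x / theta) theta^-1.
  by apply: is_derive_eq; rewrite /GRing.scale /=; ring.
have := @is_derive1_comp _ (@ln R) (fun x => 1 + x / theta) x _ _ (is_derive1_ln p0) d1.
move=> d2; apply: is_derive_eq.
have : theta + x != 0 by rewrite gt_eqF // ltr_pwDl.
have : 1 + x / theta != 0 by rewrite gt_eqF.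
by move=> h1 h2; field; rewrite h2 tN0.
Qed.

Let dinv (x : R) : 0 <= x -> is_derive x 1 (fun x => (x + theta)^-1) (- (x + theta) ^- 2).
Proof.
move=> x0; have h : x + theta != 0 by rewrite gt_eqF // ltr_wpDl.
have d1 : is_derive x (1 : R) (fun x : R => x + theta) 1.
  by apply: is_derive_eq; rewrite addr0.
have d2 := @is_deriveV _ (fun x : R => x + theta) x 1 1 h d1; apply: is_derive_eq.
by rewrite /GRing.scale /= mulr1.
Qed.

Lemma is_derive_evar_int (x : R) : 0 <= x -> is_derive x 1 evar_int (y x).
Proof.
move=> x0; have d1 := dln x0; have d2 := dinv x0.
have h : x + theta != 0 by rewrite gt_eqF // ltr_wpDl.
have h' : theta + x != 0 by rewrite addrC.
rewrite /evar_int; apply: is_derive_eq.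
rewrite /GRing.scale /= /y /eprob; by field; rewrite ?h ?h'.
Qed.

Lemma is_derive_eskew_int (x : R) : 0 <= x ->
  is_derive x 1 eskew_int (y x * (1 - 2 * y x)).
Proof.
move=> x0; have d1 := dln x0; have d2 := dinv x0.
have h : x + theta != 0 by rewrite gt_eqF // ltr_wpDl.
have h' : theta + x != 0 by rewrite addrC.
rewrite (_ : eskew_int = fun x => theta * (ln (1 + x / theta) - 5 / 3
   + 3 * theta * (x + theta)^-1 - 2 * theta ^+ 2 * (x + theta)^-1 ^+ 2
   + 2 / 3 * theta ^+ 3 * (x + theta)^-1 ^+ 3)); last first.
  apply/funext => z; rewrite /eskew_int.
  have -> : (3 * (z + theta) ^+ 3)^-1 = 3^-1 * (z + theta)^-1 ^+ 3.
    by rewrite invfM exprVn.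
  have -> : ((z + theta) ^+ 2)^-1 = (z + theta)^-1 ^+ 2 by rewrite exprVn.
  by move: (z + theta)^-1 (ln _) => u l; field.
apply: is_derive_eq.
rewrite /GRing.scale /= /y /eprob; by field; rewrite ?h ?h'.
Qed.

(** These are the positive and negative parts of [eprob x - 1 / 2]. The first decreases and the
    second increases, so even powers of them write the non-monotone [y] and [y (1 - 2 y)] as
    differences of nondecreasing functions. *)
Let up x := Num.max (eprob x) (1 / 2) - 1 / 2.
Let dn x := 1 / 2 - Num.min (eprob x) (1 / 2).

Let upE x : eprob x - 1 / 2 = up x - dn x.
Proof. by rewrite /up /dn; case: ltP => _; lra. Qed.

Let updn x : up x * dn x = 0.
Proof. by rewrite /up /dn; case: ltP => _; ring. Qed.

Let up_ge0 x : 0 <= up x.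
Proof. by rewrite subr_ge0 le_max lexx orbT. Qed.

Let dn_ge0 x : 0 <= dn x.
Proof. by rewrite subr_ge0 ge_min lexx orbT. Qed.

Let up_le x x' : 0 <= x -> x <= x' -> up x' <= up x.
Proof. by move=> x0 xx; rewrite lerD2r ge_max !le_max eprob_le // lexx orbT. Qed.

Let dn_le x x' : 0 <= x -> x <= x' -> dn x <= dn x'.
Proof. by move=> x0 xx; rewrite lerD2l lerN2 le_min !ge_min eprob_le // lexx orbT. Qed.

Let yE x : y x = 1 / 4 - up x ^+ 2 - dn x ^+ 2.
Proof.
have e : y x = 1 / 4 - (eprob x - 1 / 2) ^+ 2 by rewrite /y; field.
rewrite e upE; have -> : (up x - dn x) ^+ 2 = up x ^+ 2 + dn x ^+ 2 - 2 * (up x * dn x) by ring.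
by rewrite updn; ring.
Qed.

Let hE x : y x * (1 - 2 * y x) = 1 / 8 - 2 * up x ^+ 4 - 2 * dn x ^+ 4.
Proof.
have -> : y x * (1 - 2 * y x) = 1 / 8 - 2 * (y x - 1 / 4) ^+ 2 by field.
rewrite yE.
have -> : (1 / 4 - up x ^+ 2 - dn x ^+ 2 - 1 / 4) ^+ 2
   = up x ^+ 4 + dn x ^+ 4 + 2 * (up x * dn x) ^+ 2 by ring.
by rewrite updn; ring.
Qed.

Let n0 : 0 <= n%:R :> R. Proof. by []. Qed.

Let e0 : eprob 0 = 1.
Proof. by rewrite /eprob addr0 divff. Qed.

Let up0 : up 0 = 1 / 2.
Proof. by rewrite /up e0 max_l; lra. Qed.

Let dn0 : dn 0 = 0.
Proof. by rewrite /dn e0 min_r ?subrr //; lra. Qed.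

Let dn_half : dn n%:R <= 1 / 2.
Proof.
rewrite gerBl le_min (ltW (eprob_gt0 n0)) /=; lra.
Qed.

Let int0 : evar_int 0 = 0 /\ eskew_int 0 = 0.
Proof.
by rewrite /evar_int /eskew_int mul0r addr0 ln1 !add0r; split; field.
Qed.

Let expr2_le (a b : R) k : 0 <= a -> a <= b -> a ^+ k <= b ^+ k.
Proof. by move=> a0 ab; rewrite lerXn2r // nnegrE // (le_trans a0). Qed.

Lemma evar_ge : var_bound n theta <= \sum_(i < n) eprob i%:R * (1 - eprob i%:R).
Proof.
have fCD x x' : y x' - y x = (- up x' ^+ 2 - - up x ^+ 2) - (dn x' ^+ 2 - dn x ^+ 2).
  by rewrite !yE; ring.
have C_le x x' : 0 <= x -> x <= x' -> - up x ^+ 2 <= - up x' ^+ 2.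
  by move=> x0 xx; rewrite lerN2 expr2_le ?up_le.
have D_le x x' : 0 <= x -> x <= x' -> dn x ^+ 2 <= dn x' ^+ 2.
  by move=> x0 xx; rewrite expr2_le ?dn_le.
have := sum_ge_integral is_derive_evar_int fCD C_le D_le n.
(* The growth of [C] is at most 1 / 4, whereas [var_bound] lies at least 1 / 2 below the
   integral. *)
apply: le_trans; rewrite up0 int0.1 subr0 /var_bound -/(evar_int n%:R).
have := sqr_ge0 (up n%:R).
have : n%:R / (2 * (theta + n%:R)) <= 1 / 2.
  have tn : 0 < theta + n%:R by rewrite ltr_pwDl.
  by rewrite ler_pdivrMr ?mulr_gt0 //; have := ltW t0; lra.
lra.
Qed.

Lemma eskew_le :
  \sum_(i < n) eprob i%:R * (1 - eprob i%:R) * (1 - 2 * (eprob i%:R * (1 - eprob i%:R)))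
  + 3 <= eskew_int n%:R + 4 + n%:R / (n%:R + theta).
Proof.
pose f x := y x * (1 - 2 * y x).
have fCD x x' : f x' - f x = (- (2 * up x' ^+ 4) - - (2 * up x ^+ 4))
    - (2 * dn x' ^+ 4 - 2 * dn x ^+ 4).
  by rewrite /f !hE; ring.
have C_le x x' : 0 <= x -> x <= x' -> - (2 * up x ^+ 4) <= - (2 * up x' ^+ 4).
  by move=> x0 xx; rewrite lerN2 ler_pM2l // expr2_le ?up_le.
have D_le x x' : 0 <= x -> x <= x' -> 2 * dn x ^+ 4 <= 2 * dn x' ^+ 4.
  by move=> x0 xx; rewrite ler_pM2l // expr2_le ?dn_le.
have := sum_le_integral is_derive_eskew_int fCD C_le D_le n.
rewrite int0.2 dn0 expr0n mulr0 !subr0.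
(* The growth of [D] is at most 1 / 8, which the slack between 3 and 4 absorbs. *)
have : dn n%:R ^+ 4 <= (1 / 2) ^+ 4 by rewrite expr2_le.
have : 0 <= n%:R / (n%:R + theta) by rewrite divr_ge0 ?addr_ge0 // ltW.
rewrite (_ : (1 / 2) ^+ 4 = 1 / 16); last by field.
rewrite -/f /f /y; lra.
Qed.

End ewens_sums.

(** * Random variables whose prescribed masses sum to one *)

Section discrete_law.
Context d (T : measurableType d) (R : realType) (P : probability T R).
Variables (X : {RV P >-> R}) (N : nat) (v g : nat -> R).
Hypothesis v_inj : injective v.
Hypothesis Xg : forall m, (m < N)%N -> P [set w | X w = v m] = (g m)%:E.
Hypothesis g1 : \sum_(m < N) g m = 1.

Let A m := [set w | X w = v m].

Let mA m : measurable (A m).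
Proof.
by rewrite (_ : A m = X @^-1` [set v m]).
Qed.

Let mass : P (\big[setU/set0]_(m < N) A m) = 1%E.
Proof.
have tA : trivIset setT (fun m : 'I_N => A m).
  move=> i j _ _ [w [Ai Aj]]; apply/val_inj/v_inj.
  by rewrite -(Ai : X w = _) (Aj : X w = _).
rewrite measure_bigsetU_ord //=.
by under eq_bigr do rewrite Xg //; rewrite sumEFin g1.
Qed.

(** The prescribed atoms carry total mass 1, so [h] at [X] agrees almost everywhere with a finite
    combination of indicators. *)
Lemma discrete_integral (h : R -> R) : measurable_fun setT h ->
  (\int[P]_w (h (X w))%:E = (\sum_(m < N) g m * h (v m))%:E)%E.
Proof.
move=> mh.
pose f (m : 'I_N) w : \bar R := ((h (v m))%:E * (\1_(A m) w)%:E)%E.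
have fi m : P.-integrable setT (f m).
  by apply: integrableZl => //; apply: integrable_indic.
transitivity (\int[P]_w (\sum_(m < N) f m w))%E; last first.
  rewrite integral_sum // -sumEFin; apply: eq_bigr => m _.
  rewrite /f integralZl //; last exact: integrable_indic.
  rewrite integral_indic // setIT. by rewrite mulrC EFinM; congr (_ * _)%E; exact: Xg.
apply: ae_eq_integral => //.
- by apply/measurable_EFinP; exact: measurableT_comp.
- by apply: emeasurable_sum => m; exact: (measurable_int _ (fi m)).
have mU : measurable (\big[setU/set0]_(m < N) A m) by exact: bigsetU_measurable.
exists (~` \big[setU/set0]_(m < N) A m); split.
- exact: measurableC.
- by rewrite [LHS](probability_setC P mU) mass subee.
move=> w /= ne; apply: contrapT => wU; apply: ne => _.
have : (\big[setU/set0]_(m < N) A m) w by apply: contrapT.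
rewrite -bigcup_mkord => -[m /= mN Xm].
rewrite (bigD1 (Ordinal mN)) //= big1 ?adde0 => [|j jm]; last first.
  rewrite /f indicE memNset ?mule0 // /A /= Xm => /v_inj mj.
  by case/eqP: jm; exact/val_inj.
by rewrite /f indicE mem_set ?mule1 // Xm.
Qed.

Lemma discrete_prob (S : set R) : measurable S ->
  P (X @^-1` S) = (\sum_(m < N) g m * \1_S (v m))%:E.
Proof.
move=> mS; rewrite -discrete_integral; last exact: measurable_indic.
rewrite (eq_integral (fun w => (\1_(X @^-1` S) w)%:E)) => [|w _]; last first.
  by rewrite !indicE.
by rewrite integral_indic ?setIT //; exact: measurable_funPTI.
Qed.

Lemma discrete_mean : mean X = \sum_(m < N) g m * v m.
Proof. by rewrite /mean expectation_def (discrete_integral (@measurable_id _ _ setT)). Qed.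

Lemma discrete_variance :
  fine ('V_P[X])%E = \sum_(m < N) g m * (v m - mean X) ^+ 2.
Proof.
rewrite /variance covariance.unlock -/(mean X); move: (mean X) => c.
rewrite expectation.unlock.
rewrite -[X in fine X]/(\int[P]_w ((X w - c) * (X w - c))%:E)%E.
rewrite (@discrete_integral (fun x => (x - c) * (x - c))) //.
by apply: measurable_funM; exact: measurable_funB.
Qed.

End discrete_law.

(** * The law of K as a sum of Bernoulli variables, and its Kolmogorov distance *)

Section ewens_law.
Context {R : realType}.
Variables (theta : R) (n : nat).
Hypothesis t0 : 0 < theta.
Hypothesis n1 : (1 <= n)%N.

Let p (i : 'I_n) : R := eprob theta i%:R.
Let g := pbin p predT.

Let p01 i : 0 <= p i <= 1.
Proof. by rewrite eprob_le1 // ltW // eprob_gt0. Qed.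

Lemma sbar_coef x : sbar R n x * theta ^+ x / rising_factorial theta n = g`_x.
Proof.
have rf0 k : rising_factorial theta k != 0.
  by rewrite prodf_seq_neq0; apply/allP => i _; rewrite /= gt_eqF // ltr_pwDl.
(* Cleared of denominators and freed from [n], the identity follows by induction: both sides obey
   the Stirling recursion. *)
suff H k : (\prod_(i < k) bern (eprob theta i%:R))`_x * rising_factorial theta k
    = sbar R k x * theta ^+ x.
  by rewrite -H mulfK // /g /pbin.
rewrite /sbar; elim: k x => [|k IH] x.
  rewrite /rising_factorial !big_ord0 mulr1 coef1.
  by case: x => [|x]; rewrite ?mul1r ?expr0 // mul0r.
have rS (A : nzRingType) (a : A) : rising_factorial a k.+1 = rising_factorial a k * (a + k%:R).
  by rewrite /rising_factorial big_ord_recr.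
pose a := eprob theta k%:R; pose G := \prod_(i < k) bern (eprob theta i%:R).
have cR : (rising_factorial ('X : {poly R}) k * ('X + k%:R))`_x
    = (if x == 0%N then 0 else (rising_factorial 'X k)`_x.-1)
      + (rising_factorial 'X k)`_x * k%:R.
  by rewrite -(rmorph_nat polyC) mulrDr coefD coefMX coefMC.
have cL : (G * bern a)`_x
    = G`_x * (1 - a) + a * (if x == 0%N then 0 else G`_x.-1).
  by rewrite mulrDr coefD coefMC -scalerAr coefZ coefMX.
rewrite big_ord_recr /= -/G -/a !rS cR cL.
have tk : theta + k%:R != 0 by rewrite gt_eqF // ltr_pwDl.
have ek : a * (theta + k%:R) = theta by rewrite divfK.
have ek1 : (1 - a) * (theta + k%:R) = k%:R.
  by rewrite mulrBl ek mul1r addrC addKr.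
transitivity (G`_x * rising_factorial theta k * ((1 - a) * (theta + k%:R))
   + (if x == 0%N then 0 else G`_x.-1) * rising_factorial theta k * (a * (theta + k%:R))).
  by ring.
rewrite ek ek1 IH; case: x cR cL => [|x] _ _ /=; first by ring.
by rewrite IH exprS; ring.
Qed.

(** The variable with index 0 has success probability 1. *)
Lemma coef0_pbin_ewens : g`_0 = 0.
Proof.
rewrite -horner_coef0 /g /pbin horner_prod (bigD1 (Ordinal n1)) //=.
rewrite /bern hornerD hornerC hornerZ hornerX mulr0 addr0.
by rewrite /p /eprob addr0 divff ?gt_eqF // subrr mul0r.
Qed.

Lemma pexp_ewens h : pexp g h = \sum_(m < n) g`_m.+1 * h m.+1.
Proof.
rewrite (@pexp_widen _ n.+1) ?big_ord_recl ?coef0_pbin_ewens ?mul0r ?add0r //.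
by rewrite (leq_trans (size_pbin _)) ?card_ord.
Qed.

Let V := \sum_(i < n) p i * (1 - p i).
Let B := Num.sqrt V.

Hypothesis vb0 : 0 < var_bound n theta.

Let vbV : var_bound n theta <= V. Proof. exact: evar_ge. Qed.

Let V0 : 0 < V. Proof. exact: lt_le_trans vbV. Qed.

Let B0 : 0 < B. Proof. by rewrite sqrtr_gt0. Qed.

Let B2 : B ^+ 2 = V. Proof. by rewrite sqr_sqrtr // ltW. Qed.

Let L := \sum_(i < n) p i * (1 - p i) * (1 - 2 * (p i * (1 - p i))).

Let L0 : 0 <= L.
Proof.
apply: sumr_ge0 => i _; have := p01 i; move: (p i) => a /andP[a0 a1].
rewrite mulr_ge0 ?mulr_ge0 ?subr_ge0 //.
by have := sqr_ge0 (a - 1 / 2); lra.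
Qed.

Let gamma1_ge : (L + 3) / B ^+ 3 <= gamma1 n theta.
Proof.
have W0 : 0 < var_bound n theta `^ (3 / 2) by rewrite powR_gt0.
have WB : var_bound n theta `^ (3 / 2) <= B ^+ 3.
  have -> : B ^+ 3 = V `^ (3 / 2).
    rewrite -B2 -(powR_mulrn 2 (ltW B0)) -powRrM -powR_mulrn ?ltW //.
    by congr (_ `^ _); field.
  by apply: ge0_ler_powR; rewrite ?nnegrE ?(ltW vb0) ?(ltW V0) ?divr_ge0.
have L3 : L + 3 <= eskew_int theta n%:R + 4 + n%:R / (n%:R + theta) by exact: eskew_le.
have L30 : 0 <= L + 3 by rewrite addr_ge0.
apply: (@le_trans _ _ ((L + 3) / var_bound n theta `^ (3 / 2))).
  by rewrite ler_wpM2l // lef_pV2 ?posrE ?exprn_gt0.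
by rewrite /gamma1 ler_pM2r ?invr_gt0.
Qed.

Lemma ewens_kolmogorov (x : R) :
  `|pexp g (fun m => (atom p B m <= x)%R%:R) - ncdf x| <= 5591 / 10000 * gamma1 n theta.
Proof.
apply: (@le_trans _ _ (5591 / 10000 * ((L + 3) / B ^+ 3))); last first.
  by apply: ler_wpM2l; [lra | exact: gamma1_ge].
have [B1|B1] := leP 1 B.
  have := @kolmogorov_le _ _ p B p01 B1 B2 x; rewrite card_ord.
  move=> /(_ n1 coef0_pbin_ewens)/le_trans; apply.
  by rewrite mulrA; exact: kolmogorov_bound_le.
apply: (@le_trans _ _ 1).
  have F0 : 0 <= pexp g (fun m => (atom p B m <= x)%R%:R).
    by rewrite -[leLHS](pexp_pbin_cst p predT 0); apply: pexp_pbin_le.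
  have F1 : pexp g (fun m => (atom p B m <= x)%R%:R) <= 1.
    rewrite -[leRHS](pexp_pbin_cst p predT 1); apply: pexp_pbin_le => // m /=.
    by case: (_ <= x).
  have := ncdf_ge0 x; have := ncdf_le1 x; rewrite ler_norml; lra.
(* For [B < 1] the right side is at least [3 * 0.5591 > 1], which exceeds any difference of
   distribution functions. *)
have B31 : B ^+ 3 <= 1 by rewrite exprn_ile1 // ltW.
have : L + 3 <= (L + 3) / B ^+ 3.
  by rewrite ler_pdivlMr ?exprn_gt0 // ler_piMr // addr_ge0.
by have := L0; move: ((L + 3) / _) => y; lra.
Qed.

Context d (T : measurableType d) (P : probability T R) (K : {RV P >-> R}).
Hypothesis lawK : has_K_law K n theta.

(** The shift by one matches the support 1, ..., n of K to indices starting at 0. *)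
Let v (m : nat) : R := m.+1%:R.

Let v_inj : injective v.
Proof. by move=> i j /eqP; rewrite eqr_nat eqSS => /eqP. Qed.

Let K_law m : (m < n)%N -> P [set w | K w = v m] = (g`_m.+1)%:E.
Proof. by move=> mn; rewrite lawK // sbar_coef. Qed.

Let K_mass : \sum_(m < n) g`_m.+1 = 1.
Proof.
rewrite -(pexp_pbin_cst p predT 1) -/g pexp_ewens.
by apply: eq_bigr => m _; rewrite mulr1.
Qed.

Let K_mean : mean K = pmean p.
Proof.
rewrite (discrete_mean v_inj K_law K_mass) -(@pexp_ewens (fun m => m%:R)).
apply/eqP; rewrite -subr_eq0 -(pexp_pbin_cst p predT (pmean p)) -pexp_funB.
by rewrite pbin_mean.
Qed.

Let K_std : std_dev K = B.
Proof.
rewrite /std_dev (discrete_variance v_inj K_law K_mass) K_mean.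
by rewrite -(@pexp_ewens (fun m => (m%:R - pmean p) ^+ 2)) pbin_var.
Qed.

Lemma standardized_cdf_ewens x :
  standardized_cdf K x = (pexp g (fun m => (atom p B m <= x)%R%:R))%:E.
Proof.
rewrite /standardized_cdf /cdf /distribution /pushforward.
pose s (y : R) := (y - pmean p) / B.
have ms : measurable_fun setT s by apply: measurable_funM => //; exact: measurable_funB.
rewrite (_ : _ @^-1` _ = K @^-1` (s @^-1` `]-oo, x])); last first.
  by apply/funext => w; rewrite /= /standardize K_mean K_std.
rewrite (discrete_prob v_inj K_law K_mass); last first.
  by rewrite -[X in measurable X]setTI; exact: ms.
rewrite pexp_ewens; congr (_%:E); apply: eq_bigr => m _; congr (_ * _).
rewrite indicE; congr (nat_of_bool _)%:R.
by apply/idP/idP; rewrite inE /= in_itv.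
Qed.

End ewens_law.

Theorem theorem2p1 (R : realType) :
  exists C : R, C <= 5591 / 10000 /\
  forall theta : nat -> R,
    (forall n : nat, (1 <= n)%N -> 0 < theta n) ->
    (forall m n : nat, (1 <= m)%N -> (m <= n)%N -> theta m <= theta n) ->
  forall n0 : nat,
    (forall n : nat, (1 <= n)%N -> (n0 <= n)%N -> 0 < var_bound n (theta n)) ->
  forall n : nat, (1 <= n)%N -> (n0 <= n)%N ->
  forall (d : measure_display) (T : measurableType d) (P : probability T R)
         (K : {RV P >-> R}),
    has_K_law K n (theta n) ->
    (sup_norm (fun x : R => standardized_cdf K x - Phi x)
     <= (C * gamma1 n (theta n))%:E)%E.
Proof.
exists (5591 / 10000); split=> // theta theta0 _ n0 vb0 n n1 nn0 d T P K lawK.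
apply: ge_ereal_sup => _ [x _ <-].
have t0 := theta0 n n1; have v0 := vb0 n n1 nn0.
rewrite (standardized_cdf_ewens t0 n1 lawK) ncdfE -EFinB abse_EFin lee_fin.
exact: ewens_kolmogorov.
Qed.
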